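(* Let $\mathbb{K}$ be an algebraically closed field and $f_1,\ldots,f_s\in\mathbb{K}[x_1,\ldots,x_m]$ of degrees $d_1\ge\cdots\ge d_s$. Assume that the homogenizations $f_1^h,\ldots,f_s^h\in\mathbb{K}[x_1,\ldots,x_m,x_{m+1}]$ have finitely many common roots in $\mathbb{P}^m_{\mathbb{K}}$, and that none of these common roots lies at infinity (i.e. on $x_{m+1}=0$). Let $\mathcal{A}=\mathbb{K}[\mathbf{x}]/\langle f_1,\ldots,f_s\rangle$. Then: (1) If $s=m$, then $\delta=k:=\sum_{i=1}^m(d_i-1)$ satisfy condition $( * )$; moreover $\mathcal{A}$ is Gorenstein. (2) If $s>m$, then $\delta=k:=\sum_{i=1}^{m+1}d_i-m$ satisfy condition $( * )$.
   Context: $\mathbb{K}[\mathbf{x}]_k$ denotes polynomials of total degree $\le k$; $\langle f_1,\ldots,f_s\rangle_d:=\{\sum_i q_if_i:\deg q_i\le d-d_i\}$. Condition $( * )$ for integers $\delta$ and $k$ means: $\dim_{\mathbb{K}}\mathbb{K}[\mathbf{x}]_k/(\langle f_1,\ldots,f_s\rangle_\delta\cap\mathbb{K}[\mathbf{x}]_k)=\dim_{\mathbb{K}}\mathbb{K}[\mathbf{x}]_k/(\langle f_1,\ldots,f_s\rangle_d\cap\mathbb{K}[\mathbf{x}]_k)$ for all $d\ge\delta$. A finite-dimensional commutative $\mathbb{K}$-algebra $\mathcal{A}$ is Gorenstein if there is a $\mathbb{K}$-linear map $\Lambda:\mathcal{A}\to\mathbb{K}$ such that the bilinear form $(a,b)\mapsto\Lambda(ab)$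 is nondegenerate on $\mathcal{A}$. *)

(* Defs.v *)
From HB Require Import structures.
From mathcomp Require Import all_boot all_order all_algebra.
From mathcomp Require Import mpoly.
Set Implicit Arguments. Unset Strict Implicit. Unset Printing Implicit Defensive.
Import Order.TTheory GRing.Theory Num.Theory.
Local Open Scope ring_scope.

Section Defs.
Variables (K : fieldType) (m s : nat).
Local Notation poly := {mpoly K[m]}.

(* total degree of a (nonzero) polynomial; msize p = 1 + deg p *)
Definition mdegree n (p : {mpoly K[n]}) : nat := (msize p).-1.

(* homogenization f^h = x_{m+1}^{deg f} f(x / x_{m+1}) in K[x_1..x_m,x_{m+1}];
   the new variable x_{m+1} is the last one, ord_max *)
Definition homogenize (p : poly) : {mpoly K[m.+1]} :=
  \sum_(mn <- msupp p)
     p@_mn *: ((\prod_(i < m) 'X_(widen_ord (leqnSn m) i) ^+ mn i)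
               * 'X_(@ord_max m) ^+ (mdegree p - mdeg mn)%N).

(* v in K^{m+1} \ {0} is an affine representative of a common projective root
   of the f_i^h *)
Definition common_proj_root (f : 'I_s -> poly) (v : 'I_m.+1 -> K) : Prop :=
  (exists i, v i != 0) /\ forall j, (homogenize (f j)).@[v] = 0.

(* the common roots form finitely many points of P^m : finitely many lines *)
Definition finitely_many_proj_roots (f : 'I_s -> poly) : Prop :=
  exists (N : nat) (P : 'I_N -> 'I_m.+1 -> K),
    forall v, common_proj_root f v -> exists j c, forall i, v i = c * P j i.

Definition no_root_at_infinity (f : 'I_s -> poly) : Prop :=
  forall v, common_proj_root f v -> v ord_max != 0.

(* K[x]_k : polynomials of total degree <= k (k : int, so {0} if k < 0) *)
Definition deg_le (k : int) (p : poly) : Prop :=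
  p = 0 \/ ((mdegree p)%:Z <= k).

Definition trunc_ideal (f : 'I_s -> poly) (d : int) (p : poly) : Prop :=
  exists q : 'I_s -> poly,
    (forall i, q i = 0 \/ ((mdegree (q i))%:Z <= d - (mdegree (f i))%:Z)) /\
    p = \sum_(i < s) q i * f i.

Definition indep_mod (S : poly -> Prop) n (b : 'I_n -> poly) : Prop :=
  forall c : 'I_n -> K, S (\sum_(i < n) c i *: b i) -> forall i, c i = 0.

(* dim_K V / W = n, for W a subspace of the subspace V:
   n is the maximal number of elements of V linearly independent modulo W *)
Definition quot_dim (V W : poly -> Prop) (n : nat) : Prop :=
  (exists b : 'I_n -> poly, (forall i, V (b i)) /\ indep_mod W b) /\
  (forall n' (b : 'I_n' -> poly), (forall i, V (b i)) -> indep_mod W b ->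
     (n' <= n)%N).

Definition cond_star (f : 'I_s -> poly) (delta k : int) : Prop :=
  exists n : nat, forall d : int, delta <= d ->
    quot_dim (deg_le k) (fun p => trunc_ideal f d p /\ deg_le k p) n.

Definition in_ideal (f : 'I_s -> poly) (p : poly) : Prop :=
  exists q : 'I_s -> poly, p = \sum_(i < s) q i * f i.

(* A = K[x]/<f> is a finite-dimensional Gorenstein algebra: finite-dimensional,
   and some K-linear Lambda : A -> K (a linear form on K[x] vanishing on <f>)
   makes (a,b) |-> Lambda(ab) nondegenerate on A *)
Definition gorenstein_quotient (f : 'I_s -> poly) : Prop :=
  (exists (n : nat) (b : 'I_n -> poly),
     forall p, exists c : 'I_n -> K, in_ideal f (p - \sum_(i < n) c i *: b i)) /\
  exists Lambda : poly -> K,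
    (forall (a : K) (p q : poly), Lambda (a *: p + q) = a * Lambda p + Lambda q) /\
    (forall p, in_ideal f p -> Lambda p = 0) /\
    (forall a, (forall b, Lambda (a * b) = 0) -> in_ideal f a).

End Defs.

(* Main.v *)
(* Write F_i for the leading form of f_i.  Having no root at infinity means that
   the F_i have no common zero besides the origin.  Starting from the regular
   sequence x_1, ..., x_m, exchange x_i for a generic form
   G_i = sum_(k >= i) z^(k-i) x_i^(d_i-d_k) F_k, one index at a time.  Modulo the
   ideal J of the other members of the sequence, some power of x_i is a multiple
   a * G_i: otherwise the finite-dimensional algebra K[x]/(J, x_i - 1) has a
   point at which all the F_k vanish.  The identity x_i^E = a G_i mod J
   transports from x_i to G_i the facts that it is a nonzerodivisor modulo J
   and that the quotient by J and it has a one-dimensional socle in degree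
   sum (d_j - 1), with perfect pairing into it.

   The G_i are the leading forms of polynomials g_i that are obtained from the
   f_i by a unitriangular change of generators, so the truncated ideals of f do
   not change.  As G_1, ..., G_m is regular, syzygies of the G_i lift and the g_i
   form an H-basis: an element of degree <= k needs no coefficients of higher
   degree.  When s > m, the coefficients of the f_i with i > m are first reduced
   modulo the g_j to degree <= sum (d_j - 1), which is where the value of k in (2)
   comes from.  When s = m, the socle form of K[x]/(G) extends to a form on
   K[x]/(f), and the pairing is nondegenerate because it is so on leading forms. *)

Require Import Defs.
From HB Require Import structures.
From Stdlib Require Import Classical IndefiniteDescription.
From mathcomp Require Import all_boot all_order all_algebra.
From mathcomp Require Import mpoly zify ring.
Set Implicit Arguments. Unset Strict Implicit. Unset Printing Implicit Defensive.
Import Order.TTheory GRing.Theory Num.Theory.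
Local Open Scope ring_scope.

(** * Homogeneous components and degree bounds *)

Section HomogeneousParts.
Variables (K : fieldType) (n : nat).
Local Notation R := {mpoly K[n]}.
Local Notation hc := (pihomog mdeg).

Lemma mcoeff_pihomog d (p : R) u :
  (hc d p)@_u = if mdeg u == d then p@_u else 0.
Proof.
have [ud|ud] := eqVneq (mdeg u) d; last first.
  exact: (dhomog_nemf_coeff (pihomogP mdeg d p)).
have ltk : (d < (msize p + d).+1)%N by lia.
rewrite [in RHS](@pihomog_partitionE _ _ mdeg (msize p + d).+1 p); last by lia.
rewrite [RHS](raddf_sum (mcoeff u)) [RHS](bigD1 (Ordinal ltk)) //= [X in _ = _ + X]big1 ?addr0 // => i ni.
apply: (dhomog_nemf_coeff (pihomogP mdeg i p)).
by apply: contra ni => /eqP h; apply/eqP/val_inj; rewrite /= -h -ud.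
Qed.

Lemma msize_leP (p : R) k :
  reflect (forall u, (k <= mdeg u)%N -> p@_u = 0) (msize p <= k)%N.
Proof.
apply: (iffP idP) => [le u ku | h].
  by apply: memN_msupp_eq0; apply: msize_mdeg_ge; apply: leq_trans le ku.
rewrite msizeE; apply/bigmax_leqP_seq => u uin _.
rewrite ltnNge; apply: contraL uin => /h.
by rewrite mcoeff_msupp => ->; rewrite eqxx.
Qed.

Lemma pihomog_msize_le d (p : R) : (msize p <= d)%N -> hc d p = 0.
Proof.
move/msize_leP => h; apply/mpolyP => u; rewrite mcoeff_pihomog mcoeff0.
by case: eqP => // ud; rewrite h ?ud.
Qed.

Lemma msize_drop_top d (p q : R) : (msize p <= d.+1)%N -> (msize q <= d.+1)%N ->
  hc d p = hc d q -> (msize (p - q) <= d)%N.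
Proof.
move=> /msize_leP hp /msize_leP hq pq; apply/msize_leP => u; rewrite leq_eqVlt.
case/orP => [/eqP du|du]; last by rewrite mcoeffB hp // hq // subrr.
have := congr1 (mcoeff u) pq; rewrite !mcoeff_pihomog -du eqxx mcoeffB => ->.
by rewrite subrr.
Qed.

Lemma dhomog_msize_le d (p : R) : p \is d.-homog -> (msize p <= d.+1)%N.
Proof.
move=> hp; apply/msize_leP => u du.
by apply: (dhomog_nemf_coeff hp); rewrite gtn_eqF.
Qed.

Lemma msize_addl k (p q : R) :
  (msize p <= k)%N -> (msize q <= k)%N -> (msize (p + q) <= k)%N.
Proof. by move=> hp hq; apply: leq_trans (msizeD_le _ _) _; rewrite geq_max hp. Qed.

Lemma msize_subl k (p q : R) :
  (msize p <= k)%N -> (msize q <= k)%N -> (msize (p - q) <= k)%N.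
Proof. by move=> hp hq; apply: msize_addl; rewrite ?msizeN. Qed.

Lemma msize_suml (I : Type) (r : seq I) (P : pred I) (F : I -> R) k :
  (forall i, P i -> (msize (F i) <= k)%N) -> (msize (\sum_(i <- r | P i) F i) <= k)%N.
Proof.
move=> h; apply: (big_ind (fun p => msize p <= k)%N) => //; first by rewrite msize0.
exact: msize_addl.
Qed.

Lemma msize_mull a b (p q : R) :
  (msize p <= a)%N -> (msize q <= b.+1)%N -> (msize (p * q) <= a + b)%N.
Proof.
have [->|p0] := eqVneq p 0; first by rewrite mul0r msize0.
have [->|q0] := eqVneq q 0; first by rewrite mulr0 msize0.
move=> hp hq; rewrite msizeM // -ltnS prednK ?addn_gt0 ?lt0n ?msize_poly_eq0 ?p0 //.
by rewrite -addnS leq_add.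
Qed.

Lemma pihomog_mulr d e (p g : R) : g \is e.-homog ->
  hc d (p * g) = if (e <= d)%N then hc (d - e) p * g else 0.
Proof.
move=> hg; have ltk : (d < (msize p + d).+1)%N by lia.
rewrite [in LHS](@pihomog_partitionE _ _ mdeg (msize p + d).+1 p); last by lia.
have hi (i : 'I_((msize p + d).+1)) : hc i p * g \is (i + e).-homog.
  exact: dhomogM (pihomogP _ _ _) hg.
rewrite mulr_suml raddf_sum; case: ifP => led.
  have ltd : (d - e < (msize p + d).+1)%N by lia.
  rewrite (bigD1 (Ordinal ltd)) //= big1 ?addr0 => [|i ni].
    by rewrite pihomog_dE // -[X in X.-homog](subnK led); apply: (hi (Ordinal ltd)).
  apply: pihomog_ne0 (hi i); apply: contra ni => /eqP h; apply/eqP/val_inj => /=; lia.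
by rewrite big1 // => i _; apply: pihomog_ne0 (hi i); lia.
Qed.

Lemma pihomog_top_mul a b (p q : R) : (msize p <= a.+1)%N -> (msize q <= b.+1)%N ->
  hc (a + b) (p * q) = hc a p * hc b q.
Proof.
move=> hp hq; have hp' : (msize (p - hc a p) <= a)%N.
  by rewrite msize_drop_top ?pihomog_id // dhomog_msize_le // pihomogP.
have hq' : (msize (q - hc b q) <= b)%N.
  by rewrite msize_drop_top ?pihomog_id // dhomog_msize_le // pihomogP.
rewrite -[p in LHS](subrK (hc a p)) mulrDl pihomogD.
rewrite (pihomog_msize_le (msize_mull hp' hq)) add0r.
rewrite -[q in LHS](subrK (hc b q)) mulrDr pihomogD.
rewrite [X in X + _ = _]pihomog_msize_le; last first.
  by rewrite mulrC addnC msize_mull // dhomog_msize_le // pihomogP.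
by rewrite add0r pihomog_dE // dhomogM // pihomogP.
Qed.

End HomogeneousParts.

(** * Graded ideals and nonzerodivisors modulo them *)

Section Ideals.
Variables (K : fieldType) (n : nat).
Local Notation R := {mpoly K[n]}.
Local Notation hc := (pihomog mdeg).
Implicit Types (J I : R -> Prop) (p q u v w g h l : R).

Definition ideal J : Prop :=
  [/\ J 0, forall p q, J p -> J q -> J (p + q) & forall p q, J q -> J (p * q)].

Definition hideal J : Prop := ideal J /\ forall e p, J p -> J (hc e p).

(** This is the ideal [J + (g)], for a [J] that need not come with generators. *)
Definition addI J g : R -> Prop := fun p => exists q, J (p - q * g).

Definition nzd J g : Prop := forall u, J (g * u) -> J u.

Lemma idealB J p q : ideal J -> J p -> J q -> J (p - q).
Proof. by case=> _ D M jp jq; apply: D => //; rewrite -mulN1r; apply: M. Qed.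

Lemma idealMr J p q : ideal J -> J p -> J (p * q).
Proof. by case=> _ _ M jp; rewrite mulrC; apply: M. Qed.

Lemma idealZ J c p : ideal J -> J p -> J (c *: p).
Proof. by case=> _ _ M jp; rewrite -mul_mpolyC; apply: M. Qed.

Lemma ideal_sum J (T : Type) (r : seq T) (P : pred T) (F : T -> R) :
  ideal J -> (forall i, P i -> J (F i)) -> J (\sum_(i <- r | P i) F i).
Proof. by case=> j0 D _ h; apply: (big_ind J). Qed.

Lemma ideal_congr J p q : ideal J -> J (p - q) -> J q -> J p.
Proof. by case=> _ D _ a b; rewrite -(subrK q p); apply: D. Qed.

Lemma ideal_addI J g : ideal J -> ideal (addI J g).
Proof.
move=> iJ; case: (iJ) => j0 D M; split.
- by exists 0; rewrite mul0r subr0.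
- move=> p q [a ja] [b jb]; exists (a + b).
  by have := D _ _ ja jb; congr J; ring.
- by move=> p q [a ja]; exists (p * a); rewrite -mulrA -mulrBr; apply: M.
Qed.

Lemma addI_base J g p : J p -> addI J g p.
Proof. by move=> jp; exists 0; rewrite mul0r subr0. Qed.

Lemma addI_gen J g q : ideal J -> addI J g (q * g).
Proof. by case=> j0 _ _; exists q; rewrite subrr. Qed.

Lemma hideal_addI J g e : hideal J -> g \is e.-homog -> hideal (addI J g).
Proof.
case=> iJ H hg; split=> [|d p [q jq]]; first exact: ideal_addI.
have := H d _ jq; rewrite pihomogB (pihomog_mulr _ _ hg); case: ifP => _ jd.
  by exists (hc (d - e) q).
by apply: addI_base; rewrite subr0 in jd.
Qed.

(** Taking the component of degree [e] makes the cofactor of [g] homogeneous. For [e < c] the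
    truncated [e - c] is 0, hence the separate clause [w = 0]. *)
Lemma addI_dhomog J g c e u : hideal J -> g \is c.-homog -> u \is e.-homog ->
  addI J g u ->
  exists w, [/\ J (u - w * g), w \is (e - c).-homog & (e < c)%N -> w = 0].
Proof.
move=> [iJ H] hg hu [q jq]; have := H e _ jq.
rewrite pihomogB (pihomog_mulr _ _ hg) (pihomog_dE hu); case: leqP => ce jd.
  by exists (hc (e - c) q); split=> //; exact: pihomogP.
by exists 0; split=> //; rewrite ?mul0r // dhomog0.
Qed.

Lemma hideal_parts J p : hideal J -> (forall e, J (hc e p)) -> J p.
Proof.
move=> [iJ _] h; rewrite (pihomog_partitionE (leqnn (msize p))).
by apply: ideal_sum.
Qed.

Lemma nzd_dhomog J g c : hideal J -> g \is c.-homog ->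
  (forall e u, u \is e.-homog -> J (g * u) -> J u) -> nzd J g.
Proof.
move=> hJ hg h u ju; apply: hideal_parts => // e; apply: (h e).
  exact: pihomogP.
have := hJ.2 (e + c)%N _ ju.
by rewrite mulrC (pihomog_mulr _ _ hg) leq_addl addnK mulrC.
Qed.

Lemma nzdX J g k : nzd J g -> nzd J (g ^+ k).
Proof.
move=> h; elim: k => [|k ih] u; first by rewrite expr0 mul1r.
by rewrite exprS -mulrA => /h /ih.
Qed.

Lemma nzd_factor J a g x : ideal J -> J (x - a * g) -> nzd J x -> nzd J g.
Proof.
move=> iJ jx nx u ju; apply: nx; case: (iJ) => _ D M.
have -> : x * u = (x - a * g) * u + a * (g * u) by ring.
by apply: D; [apply: idealMr | apply: M].
Qed.

(* Graded Nakayama: the elements killed by g modulo J form a module U with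
   U = J + h U. *)
Lemma nzd_descend J g h c e : hideal J -> g \is c.-homog -> h \is e.-homog ->
  (0 < e)%N -> nzd J h -> nzd (addI J h) g -> nzd J g.
Proof.
move=> hJ hg hh e0 nh ng; apply: (nzd_dhomog hJ hg) => k.
have [k' lek] := ubnP k; elim: k' k lek => // k' ih k lek u hu ju.
have iJ := hJ.1; have [_ D M] := iJ.
have [w [jw hw w0]] := addI_dhomog hJ hh hu (ng _ (addI_base _ ju)).
have [ke|ke] := ltnP k e; first by move: jw; rewrite w0 // mul0r subr0.
have jgw : J (g * w).
  apply: nh; have -> : h * (g * w) = g * u - g * (u - w * h) by ring.
  by apply: idealB => //; apply: M.
rewrite -(subrK (w * h) u); apply: D => //; apply: idealMr => //.
by apply: (ih (k - e)%N) => //; lia.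
Qed.

(** If [h u = v g] modulo [J], then [v = w h] because [g] is a nonzerodivisor modulo [J + (h)];
    cancelling [h] gives [u = w g]. *)
Lemma nzd_swap J g h : ideal J -> nzd J h -> nzd (addI J h) g ->
  nzd (addI J g) h.
Proof.
move=> iJ nh ng u [v jv]; have [_ D M] := iJ.
have /ng [w jw] : addI J h (g * v).
  exists u; have -> : g * v - u * h = (-1) * (h * u - v * g) by ring.
  exact: M.
exists w; apply: nh.
have -> : h * (u - w * g) = (h * u - v * g) + g * (v - w * h) by ring.
by apply: D => //; apply: M.
Qed.

(** * Regular sequences of forms *)

Definition idl k (a : 'I_k -> R) (S : {set 'I_k}) : R -> Prop :=
  fun p => exists q : 'I_k -> R, p = \sum_(i in S) q i * a i.

Lemma idl_ideal k (a : 'I_k -> R) S : ideal (idl a S).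
Proof.
split.
- by exists (fun _ => 0); rewrite big1 // => i _; rewrite mul0r.
- move=> p q [x ->] [y ->]; exists (fun i => x i + y i).
  by rewrite -big_split; apply: eq_bigr => i _; rewrite mulrDl.
- move=> p q [x ->]; exists (fun i => p * x i).
  by rewrite mulr_sumr; apply: eq_bigr => i _; rewrite mulrA.
Qed.

Lemma idl_gen k (a : 'I_k -> R) (S : {set 'I_k}) i : i \in S -> idl a S (a i).
Proof.
move=> iS; exists (fun j => (j == i)%:R).
rewrite (bigD1 i) //= eqxx mul1r big1 ?addr0 // => j /andP [_ /negPf ->].
by rewrite mul0r.
Qed.

Lemma idl_min k (a : 'I_k -> R) (S : {set 'I_k}) J p : ideal J ->
  (forall i, i \in S -> J (a i)) -> idl a S p -> J p.
Proof.
move=> iJ h [q ->]; apply: ideal_sum => // i iS.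
by have [_ _ M] := iJ; apply/M/h.
Qed.

Lemma idl_hideal k (a : 'I_k -> R) (d : 'I_k -> nat) S :
  (forall i, a i \is (d i).-homog) -> hideal (idl a S).
Proof.
move=> ha; split=> [|e p [q ->]]; first exact: idl_ideal.
rewrite raddf_sum; apply: ideal_sum => [|i iS]; first exact: idl_ideal.
rewrite /= (pihomog_mulr _ _ (ha i)); case: ifP => _.
  by have [_ _ M] := idl_ideal a S; apply/M/idl_gen.
by have [] := idl_ideal a S.
Qed.

Lemma idl_congr k (a b : 'I_k -> R) (S : {set 'I_k}) p :
  (forall i, i \in S -> a i = b i) -> idl a S p -> idl b S p.
Proof.
move=> ab; apply: idl_min => [|i iS]; first exact: idl_ideal.
by rewrite ab //; apply: idl_gen.
Qed.

Lemma idl_setU1 k (a : 'I_k -> R) (S : {set 'I_k}) i p :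
  idl a (i |: S) p <-> addI (idl a S) (a i) p.
Proof.
split; last first.
  move=> [q jq]; apply: (ideal_congr (q := q * a i) (idl_ideal a _)).
    apply: idl_min jq => [|j jS]; first exact: idl_ideal.
    by apply: idl_gen; rewrite inE jS orbT.
  by have [_ _ M] := idl_ideal a (i |: S); apply/M/idl_gen; rewrite setU11.
apply: idl_min => [|j]; first exact/ideal_addI/idl_ideal.
rewrite !inE => /orP [/eqP ->|jS]; last exact/addI_base/idl_gen.
by rewrite -[X in addI _ _ X]mul1r; apply/addI_gen/idl_ideal.
Qed.

Lemma nzd_iff I J g : (forall p, I p <-> J p) -> nzd I g -> nzd J g.
Proof. by move=> IJ h u /IJ /h /IJ. Qed.

(** Quantifying over all subsets, not only initial segments, makes the notion independent of the
    order, so that a member can be exchanged at any place. *)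
Definition strongly_regular k (a : 'I_k -> R) : Prop :=
  forall (S : {set 'I_k}) i, i \notin S -> nzd (idl a S) (a i).

Lemma strongly_regular_eq k (a b : 'I_k -> R) :
  a =1 b -> strongly_regular a -> strongly_regular b.
Proof.
move=> ab reg S j jS; have := reg S j jS; rewrite ab; apply: nzd_iff => p.
by split; apply: idl_congr => i _; rewrite ab.
Qed.

(** The hypothesis on [b i0] concerns the largest set avoiding [i0]; [nzd_descend] carries it to the
    smaller ones by removing one index at a time. Sets containing [i0] follow by [nzd_swap]. *)
Lemma strongly_regular_exchange k (a b : 'I_k -> R) (d : 'I_k -> nat) c i0 :
  (forall i, a i \is (d i).-homog) -> (forall i, 0 < d i)%N ->
  b i0 \is c.-homog -> (forall i, i != i0 -> b i = a i) ->
  strongly_regular a -> nzd (idl a [set~ i0]) (b i0) -> strongly_regular b.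
Proof.
move=> ha d0 hb ba sa nb.
have step (S : {set 'I_k}) : i0 \notin S -> nzd (idl a S) (b i0).
  have [N] := ubnP #|~: S|; elim: N S => // N ih S leN i0S.
  have [eqS|neS] := eqVneq S [set~ i0]; first by rewrite eqS.
  have sub : S \subset [set~ i0].
    by apply/subsetP => i iS; rewrite !inE; apply: contraNneq i0S => <-.
  have /properP [_ [i]] : S \proper [set~ i0] by rewrite properEneq neS.
  rewrite !inE => ii0 iS.
  apply: (nzd_descend (idl_hideal S ha) hb (ha i) (d0 i) (sa _ _ iS)).
  apply: (nzd_iff (fun p => idl_setU1 a S i p)); apply: ih.
    have : (~: (i |: S)) \proper ~: S.
      rewrite properC; apply/properP; split; first exact: subsetUr.
      by exists i => //; rewrite setU11.
    by move=> /proper_card; lia.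
  by rewrite !inE negb_or eq_sym ii0.
have eqI (S : {set 'I_k}) : i0 \notin S -> forall p, idl a S p <-> idl b S p.
  move=> iS p; split; apply: idl_congr => i iiS; rewrite ba //;
  by apply: contraNneq iS => <-.
move=> S i iS; have [eqi|nei] := eqVneq i i0.
  by rewrite eqi in iS *; apply: (nzd_iff (eqI S iS)); apply: step.
rewrite ba //; have [i0S|i0S] := boolP (i0 \in S); last first.
  by apply: (nzd_iff (eqI S i0S)); apply: sa.
pose S' := S :\ i0; have i0S' : i0 \notin S' by rewrite !inE eqxx.
have iS' : i \notin S' by rewrite !inE negb_and iS orbT.
have eqS : S = i0 |: S' by rewrite setD1K.
have : nzd (addI (idl a S') (b i0)) (a i).
  apply: nzd_swap; [exact: idl_ideal | exact: sa |].
  apply: (nzd_iff (fun p => idl_setU1 a S' i p)); apply: step.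
  by rewrite !inE negb_or eq_sym nei eqxx.
apply: nzd_iff => p; rewrite eqS idl_setU1; split=> -[q jq]; exists q;
by apply/(eqI S' i0S').
Qed.

(** * Socle forms on graded quotients *)

Definition linform (lam : R -> K) : Prop :=
  forall c p q, lam (c *: p + q) = c * lam p + lam q.

Lemma linformB lam p q : linform lam -> lam (p - q) = lam p - lam q.
Proof. by move=> L; rewrite addrC -scaleN1r L mulN1r addrC. Qed.

(** Perfect pairing of degree [e] with degree [s - e]. For [e > s] the last premise is vacuous, so
    [I] contains every form of degree above [s]. *)
Definition socle_form I s (lam : R -> K) : Prop :=
  [/\ linform lam, forall p, I p -> p \is s.-homog -> lam p = 0
    & forall e u, u \is e.-homog ->
      (forall v, (e <= s)%N -> v \is (s - e).-homog -> lam (u * v) = 0) -> I u].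

Definition graded_gorenstein I s : Prop := exists lam, socle_form I s lam.

Lemma graded_gorenstein_large I s e u : graded_gorenstein I s ->
  u \is e.-homog -> (s < e)%N -> I u.
Proof.
move=> [lam [_ _ nd]] hu se; apply: nd hu _ => v es.
by move: (leq_trans se es); rewrite ltnn.
Qed.

Lemma graded_gorenstein_iff I J s : (forall p, I p <-> J p) ->
  graded_gorenstein I s -> graded_gorenstein J s.
Proof.
move=> IJ [lam [L Z N]]; exists lam; split=> //.
  by move=> p /IJ; apply: Z.
by move=> e u hu h; apply/IJ; apply: N h.
Qed.

(* The form for l^(k+1) reads off the class of w in the degree t from
   u = l^k w mod J. *)
Lemma graded_gorensteinX J l t k : hideal J -> l \is 1.-homog -> nzd J l ->
  graded_gorenstein (addI J l) t -> graded_gorenstein (addI J (l ^+ k.+1)) (t + k).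
Proof.
move=> hJ hl nl [lam slam]; have [L Z N] := slam.
have large e u : u \is e.-homog -> (t < e)%N -> addI J l u.
  by move=> hu; apply: graded_gorenstein_large hu; exists lam.
have iJ := hJ.1; have [J0 D M] := iJ.
have lift : forall j u, u \is (t + j).-homog ->
    exists w, w \is t.-homog /\ J (u - w * l ^+ j).
  elim=> [|j ih] u hu.
    by exists u; rewrite addn0 in hu; rewrite hu mulr1 subrr.
  have lt : (t < t + j.+1)%N by lia.
  have [w1 [j1 h1 _]] := addI_dhomog hJ hl hu (large _ _ hu lt).
  have [|w [hw jw]] := ih w1.
    by move: h1; congr (_ \is _.-homog); lia.
  exists w; split=> //.
  have -> : u - w * l ^+ j.+1 = (u - w1 * l) + (w1 - w * l ^+ j) * l.
    by rewrite exprS; ring.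
  by apply: D => //; apply: idealMr.
have [W HW] := functional_choice _ (fun u => lift k _ (pihomogP mdeg (t + k) u)).
have uniq w w' : w \is t.-homog -> w' \is t.-homog -> J ((w - w') * l ^+ k) ->
    lam w = lam w'.
  move=> hw hw' jw; apply/eqP; rewrite -subr_eq0 -linformB //; apply/eqP/Z.
    by apply/addI_base/(nzdX nl (k := k)); rewrite mulrC.
  exact: rpredB.
have lamW u w : w \is t.-homog -> u \is (t + k).-homog -> J (u - w * l ^+ k) ->
    lam (W u) = lam w.
  move=> hw hu jw; have [hW jW] := HW u; apply: uniq => //.
  have -> : (W u - w) * l ^+ k =
     (u - w * l ^+ k) - (hc (t + k) u - W u * l ^+ k).
    by rewrite (pihomog_dE hu); ring.
  exact: idealB.
exists (lam \o W); split=> /=.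
- move=> c p q; rewrite -L; apply: uniq.
  + by case: (HW (c *: p + q)).
  + by rewrite rpredD ?rpredZ //; [case: (HW p) | case: (HW q)].
  have [_ j1] := HW (c *: p + q); have [_ j2] := HW p; have [_ j3] := HW q.
  have -> : (W (c *: p + q) - (c *: W p + W q)) * l ^+ k =
     (c *: (hc (t + k) p - W p * l ^+ k) + (hc (t + k) q - W q * l ^+ k))
     - (hc (t + k) (c *: p + q) - W (c *: p + q) * l ^+ k).
    rewrite pihomogD linearZ /= scalerBr !mulrBl mulrDl scalerAl.
    by set A := c *: hc _ _; ring.
  by apply: idealB => //; apply: D => //; apply: idealZ.
- move=> p [q jq] hp; have [hw jw] := HW p; rewrite (pihomog_dE hp) in jw.
  apply: Z => //; exists q; apply: (nzdX nl (k := k)).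
  have -> : l ^+ k * (W p - q * l) = (p - q * l ^+ k.+1) - (p - W p * l ^+ k).
    by rewrite exprS; ring.
  exact: idealB.
- move=> e u hu h.
  (* Nondegeneracy climbs one power of [l] at a time: if [u = w l^j] modulo [J], testing against
     multiples of [l^(k-j)] shows that [lam] kills all [w v] of degree [t], so [w] lies in
     [J + (l)]. *)
  suff : forall j, (j <= k.+1)%N -> addI J (l ^+ j) u by apply.
  elim=> [|j ih] jk; first by exists u; rewrite expr0 mulr1 subrr.
  have hlj : l ^+ j \is j.-homog by rewrite -[X in X.-homog]mul1n; apply: dhomogMn.
  have [w [jw hw w0]] := addI_dhomog hJ hlj hu (ih (ltnW jk)).
  have [ej|ej] := ltnP e j.
    by move: jw; rewrite w0 // mul0r subr0 => /(addI_base _).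
  have [q jq] : addI J l w.
    apply: (N (e - j)%N) => // v le hv.
    have hkj : l ^+ (k - j) \is (k - j).-homog.
      by rewrite -[X in X.-homog]mul1n; apply: dhomogMn.
    have hwv : w * v \is t.-homog.
      by move: (dhomogM hw hv); congr (_ \is _.-homog); lia.
    have hv' : v * l ^+ (k - j) \is (t + k - e).-homog.
      by move: (dhomogM hv hkj); congr (_ \is _.-homog); lia.
    rewrite -(lamW (u * (v * l ^+ (k - j)))) //.
    + by apply: h => //; lia.
    + by move: (dhomogM hu hv'); congr (_ \is _.-homog); lia.
    have -> : u * (v * l ^+ (k - j)) - w * v * l ^+ k =
              (u - w * l ^+ j) * (v * l ^+ (k - j)).
      by rewrite -[in l ^+ k](subnK (jk : (j <= k)%N)) exprD; ring.
    exact: idealMr.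
  exists q.
  have -> : u - q * l ^+ j.+1 = (u - w * l ^+ j) + (w - q * l) * l ^+ j.
    by rewrite exprS; ring.
  by apply: D => //; apply: idealMr.
Qed.

(** Since [x = a g] modulo [J] and [a] is a nonzerodivisor, multiplication by [a] embeds the
    quotient by [J + (g)] into the quotient by [J + (x)], raising degrees by [c]; the form is pulled
    back along it. *)
Lemma graded_gorenstein_div J x a g s c : hideal J ->
  J (x - a * g) -> a \is c.-homog -> nzd J a ->
  graded_gorenstein (addI J x) (s + c) -> graded_gorenstein (addI J g) s.
Proof.
move=> hJ jx ha na [lam [L Z N]]; have iJ := hJ.1; have [J0 D M] := iJ.
exists (fun u => lam (a * u)); split.
- by move=> k p q; rewrite -L mulrDr scalerAr.
- move=> p [q jq] hp; apply: Z; last by rewrite addnC dhomogM.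
  exists q; have -> : a * p - q * x = a * (p - q * g) - q * (x - a * g) by ring.
  by apply: idealB => //; apply: M.
move=> e u hu h; have [|q jq] := N (c + e)%N (a * u) (dhomogM ha hu).
  move=> v le hv; rewrite -mulrA; apply: h; first lia.
  by move: hv; congr (_ \is _.-homog); lia.
exists q; apply: na.
have -> : a * (u - q * g) = (a * u - q * x) + q * (x - a * g) by ring.
by apply: D => //; apply: M.
Qed.

End Ideals.

(** * Zeros of ideals with finite-dimensional quotient *)

Lemma left_kernel_neq0 (K : fieldType) p q (A : 'M[K]_(p, q)) : (q < p)%N ->
  exists2 v : 'rV_p, v != 0 & v *m A = 0.
Proof.
move=> qp; have ker0 : kermx A != 0.
  rewrite -mxrank_eq0 mxrank_ker subn_eq0 -ltnNge.
  exact: leq_ltn_trans (rank_leq_col A) qp.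
exists (nz_row (kermx A)); first by rewrite nz_row_eq0.
by apply/sub_kermxP; apply: nz_row_sub.
Qed.

Section Points.
Variables (K : closedFieldType) (n : nat).
Local Notation R := {mpoly K[n]}.
Local Notation hc := (pihomog mdeg).
Implicit Types (J I H : R -> Prop) (p q u v w g h l x : R) (a : 'I_n -> K).

Definition spanned I : Prop := exists (T : finType) (b : T -> R),
  forall p, exists c : T -> K, I (p - \sum_i c i *: b i).

Definition zero_of I a : Prop := forall q, I q -> q.@[a] = 0.

Local Notation evalp q x := ((map_poly (@mpolyC n K) q).[x]).

(** With [N] spanning elements, the [N + 1] powers [x^0, ..., x^N] are linearly dependent modulo
    [I]. *)
Lemma spanned_algebraic I x : ideal I -> spanned I ->
  exists2 q : {poly K}, q != 0 & I (evalp q x).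
Proof.
move=> iI [T [b hb]]; have [c hcb] := functional_choice _ hb.
pose N := #|T|; pose A := \matrix_(j < N.+1, i < N) c (x ^+ j) (enum_val i).
have [v v0 vA] := left_kernel_neq0 A (ltnSn N).
exists (\poly_(j < N.+1) v 0 (inord j)).
  apply: contraNneq v0 => /polyP v0; apply/eqP/rowP => j.
  by move/(_ j): v0; rewrite coef_poly ltn_ord inord_val coef0 mxE.
rewrite (@horner_coef_wide _ N.+1); last first.
  by apply: leq_trans (size_poly _ _) _; apply: size_poly.
have -> : \sum_(i < N.+1) (map_poly (mpolyC n (R:=K))
     (\poly_(j < N.+1) v 0 (inord j)))`_i * x ^+ i =
   \sum_(j < N.+1) v 0 j *: (x ^+ j - \sum_i c (x ^+ j) i *: b i).
  under [RHS]eq_bigr do rewrite scalerBr scaler_sumr.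
  rewrite big_split /= sumrN.
  have -> : \sum_(j < N.+1) \sum_i v 0 j *: (c (x ^+ j) i *: b i) = 0.
    rewrite exchange_big big1 // => i _.
    have := congr1 (fun M : 'rV_N => M 0 (enum_rank i)) vA.
    rewrite !mxE => e; rewrite -[RHS](scale0r (b i)) -e scaler_suml.
    by apply: eq_bigr => j _; rewrite scalerA mxE enum_rankK.
  rewrite subr0; apply: eq_bigr => j _.
  by rewrite coef_map coef_poly ltn_ord inord_val mul_mpolyC.
by apply: ideal_sum => // j _; apply: idealZ.
Qed.

(** If every [x - z] were invertible modulo [I], the factors of the product could be cancelled one
    by one, leaving 1 in [I]. *)
Lemma ideal_linear_factor I x (r : seq K) : ideal I -> ~ I 1 ->
  I (\prod_(z <- r) (x - z%:MP)) -> exists z, ~ addI I (x - z%:MP) 1.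
Proof.
move=> iI n1 h; apply: NNPP => no.
have all z : addI I (x - z%:MP) 1 by apply: NNPP => nz; apply: no; exists z.
apply: n1; elim: r h => [|z r ih]; first by rewrite big_nil.
rewrite big_cons; set P := \prod_(_ <- _) _ => h; apply: ih; rewrite -/P.
have [q jq] := all z; have [_ D M] := iI.
have -> : P = P * (1 - q * (x - z%:MP)) + q * ((x - z%:MP) * P).
  by rewrite /P; ring.
by apply: D; apply: M.
Qed.

Lemma spanned_sub I J : (forall p, I p -> J p) -> spanned I -> spanned J.
Proof. by move=> IJ [T [b h]]; exists T, b => p; have [c /IJ] := h p; exists c. Qed.

Lemma ideal_closed_root I x : ideal I -> spanned I -> ~ I 1 ->
  exists z, ~ addI I (x - z%:MP) 1.
Proof.
move=> iI sI n1; have [q q0 jq] := spanned_algebraic x iI sI.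
have [r qr] := closed_field_poly_normal q.
apply: (ideal_linear_factor (r := r) iI n1).
have -> : \prod_(z <- r) (x - z%:MP) = (lead_coef q)^-1 *: evalp q x.
  rewrite {2}qr -mul_polyC rmorphM /= map_polyC hornerM hornerC /=.
  rewrite mul_mpolyC scalerA mulVf ?lead_coef_eq0 // scale1r.
  rewrite rmorph_prod horner_prod; apply: eq_bigr => z _.
  by rewrite rmorphB /= map_polyX map_polyC !hornerE.
exact: idealZ.
Qed.

(** It suffices to compare on the variables. This serves for evaluation at a point, for setting some
    variables to 0 and for the constant term. *)
Lemma rmorph_mod I (phi : {rmorphism R -> R}) q : ideal I ->
  (forall c, phi c%:MP = c%:MP) -> (forall i, I ('X_i - phi 'X_i)) -> I (q - phi q).
Proof.
move=> iI phiC hX; have [I0 D M] := iI.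
have mulc p p' : I (p - phi p) -> I (p' - phi p') -> I (p * p' - phi (p * p')).
  move=> h h'; rewrite rmorphM.
  have -> : p * p' - phi p * phi p' = (p - phi p) * p' + phi p * (p' - phi p').
    by ring.
  by apply: D; [apply: idealMr | apply: M].
have one : I (1 - phi 1) by rewrite rmorph1 subrr.
elim/mpolyind: q => [|c u p _ _ ih]; first by rewrite rmorph0 subrr.
have -> : c *: 'X_[u] + p - phi (c *: 'X_[u] + p) =
   c *: ('X_[u] - phi 'X_[u]) + (p - phi p).
  by rewrite -!mul_mpolyC rmorphD rmorphM phiC; ring.
apply: D => //; apply: idealZ => //.
rewrite mpolyXE_id; apply: (big_ind (fun p => I (p - phi p))) => // i _.
elim: (u i) => [|k ihk]; first by rewrite expr0.
by rewrite exprS; apply: mulc.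
Qed.

Lemma meval_mod I a q : ideal I -> (forall i, I ('X_i - (a i)%:MP)) ->
  I (q - (q.@[a])%:MP).
Proof.
move=> iI hX; pose phi : {rmorphism R -> R} := @mpolyC n K \o meval a.
apply: (rmorph_mod (phi := phi)) => // [c|i] /=; first by rewrite mevalC.
by rewrite mevalXU.
Qed.

(** A weak Nullstellensatz: relations [X_i = z_i] are added one variable at a time, each [z_i]
    chosen so that the ideal stays proper. *)
Lemma zero_exists I : ideal I -> spanned I -> ~ I 1 -> exists a, zero_of I a.
Proof.
move=> iI sI n1.
have step : forall k, exists I', [/\ ideal I', forall p, I p -> I' p, ~ I' 1 &
    forall i : 'I_n, (i < k)%N -> exists z, I' ('X_i - z%:MP)].
  elim=> [|k [I' [iI' sub n1' hk]]]; first by exists I.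
  have [kn|kn] := ltnP k n; last first.
    exists I'; split=> // i ik; apply: hk; exact: leq_trans (ltn_ord i) kn.
  have [z hz] := ideal_closed_root 'X_(Ordinal kn) iI' (spanned_sub sub sI) n1'.
  exists (addI I' ('X_(Ordinal kn) - z%:MP)); split=> //.
  - exact: ideal_addI.
  - by move=> p /sub; apply: addI_base.
  move=> i; rewrite ltnS leq_eqVlt => /orP [/eqP ik|ik].
    exists z; rewrite (_ : i = Ordinal kn); last exact: val_inj.
    by rewrite -[X in addI _ _ X]mul1r; apply: addI_gen.
  by have [z' hz'] := hk i ik; exists z'; apply: addI_base.
have [I' [iI' sub n1' hX]] := step n.
have [a ha] := functional_choice _ (fun i : 'I_n => hX i (ltn_ord i)).
exists a => q /sub Iq; apply/eqP; apply: contra_notT n1' => qa0.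
have [_ D M] := iI'.
have -> : 1 = ((q.@[a])^-1)%:MP * (q - (q - (q.@[a])%:MP)) :> R.
  by rewrite subKr -mpolyCM mulVf.
by apply: M; apply: idealB => //; apply: meval_mod.
Qed.

(** Each variable satisfies a nonzero polynomial modulo [I], so the coordinates of all zeros are
    among the roots of the product of these polynomials. *)
Lemma zero_coords I : ideal I -> spanned I ->
  exists rs : seq K, forall a, zero_of I a -> forall i, a i \in rs.
Proof.
move=> iI sI.
have alg (i : 'I_n) : exists q : {poly K}, q != 0 /\ I (evalp q 'X_i).
  by have [q] := spanned_algebraic 'X_i iI sI; exists q.
have [q hq] := functional_choice _ alg.
have [rs eqrs] := closed_field_poly_normal (\prod_i q i).
have q0 : \prod_i q i != 0 by apply/prodf_neq0 => i _; case: (hq i).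
exists rs => a za i; have [_ /za] := hq i.
rewrite -(horner_map (meval a)) /= mevalXU -map_poly_comp.
rewrite (_ : map_poly _ (q i) = q i); last first.
  by apply: map_poly_id => z _ /=; rewrite mevalC.
move=> qa; have : root (\prod_i q i) (a i).
  by rewrite /root (bigD1 i) //= hornerM qa mul0r.
by rewrite eqrs rootZ ?lead_coef_eq0 // root_prod_XsubC.
Qed.

(** Finitely many points have coordinates in the list of [zero_coords]; the product of the nonzero
    [P] at these points has a nonroot. [Pext] stands in for functional extensionality. *)
Lemma zeros_avoid I (P : ('I_n -> K) -> {poly K}) : ideal I -> spanned I ->
  (forall a b, a =1 b -> P a = P b) -> (forall a, zero_of I a -> P a != 0) ->
  exists t, forall a, zero_of I a -> (P a).[t] != 0.
Proof.
move=> iI sI Pext P0; have [rs hrs] := zero_coords iI sI.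
pose pt (g : {ffun 'I_n -> 'I_(size rs)}) := fun i => nth 0 rs (g i).
have Q0 : \prod_g (if P (pt g) == 0 then 1 else P (pt g)) != 0.
  by apply/prodf_neq0 => g _; case: ifP => [_|->//]; rewrite oner_neq0.
have /closed_nonrootP [t] := Q0; rewrite /root horner_prod => /prodf_neq0 ht.
exists t => a za.
have lti i : (index (a i) rs < size rs)%N by rewrite index_mem hrs.
pose g : {ffun 'I_n -> 'I_(size rs)} := [ffun i => Ordinal (lti i)].
have eqP : P a = P (pt g).
  by apply: Pext => i; rewrite /pt ffunE /= nth_index // hrs.
by have := ht g isT; rewrite -eqP (negPf (P0 a za)).
Qed.

(** From [1 = b (l - 1)] modulo [H], comparing components gives [b_e = - l^e] for every [e], and
    [b_e] vanishes for large [e]. *)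
Lemma dehomogenize_unit H l : hideal H -> l \is 1.-homog -> addI H (l - 1) 1 ->
  exists E, H (l ^+ E).
Proof.
move=> hH hl [b jb]; have [iH Hh] := hH; have [H0 D M] := iH.
have hb e : H (hc e b + l ^+ e).
  elim: e => [|e ih].
    have := Hh 0%N _ jb; rewrite mulrBr mulr1 !pihomogB (pihomog_mulr _ _ hl) /=.
    by rewrite (pihomog_dE (dhomog1 _ _)) sub0r opprK addrC expr0.
  have := Hh e.+1 _ jb; rewrite mulrBr mulr1 !pihomogB (pihomog_mulr _ _ hl) /=.
  rewrite (pihomog_ne0 _ (dhomog1 _ _)) // sub0r subSS subn0 opprB => h.
  have -> : hc e.+1 b + l ^+ e.+1 =
     (hc e.+1 b - hc e b * l) + (hc e b + l ^+ e) * l by rewrite exprS; ring.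
  by apply: D => //; apply: idealMr.
exists (msize b); have := hb (msize b).
by rewrite pihomog_msize_le // add0r.
Qed.

(* V(J, l - 1) is finite, so a generic member of a pencil of forms without
   common zeros on it is invertible modulo (J, l - 1). *)
Lemma generic_form J l t D r (Q : pred 'I_r) (eps : 'I_r -> nat) (F : 'I_r -> R) :
  hideal J -> l \is 1.-homog ->
  (forall e u, u \is e.-homog -> (t < e)%N -> addI J l u) ->
  (forall k, Q k -> F k \is D.-homog) -> {in Q &, injective eps} ->
  (forall a, zero_of J a -> l.@[a] = 1 -> exists2 k, Q k & (F k).@[a] != 0) ->
  exists z E, addI J (\sum_(k < r | Q k) z ^+ eps k *: F k) (l ^+ E).
Proof.
move=> hJ hl large hF inj noz; have iJ := hJ.1; have [J0 JD JM] := iJ.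
pose I := addI J (l - 1); have iI : ideal I by apply: ideal_addI.
have [I0 ID IM] := iI.
(* A form of degree above [t] is some [w l] modulo [J], hence [w] modulo [I], of one degree less. So
   monomials of degree at most [t] span the quotient by [I]. *)
have red_homog e : forall u, u \is e.-homog ->
    exists u', (msize u' <= t.+1)%N /\ I (u - u').
  elim: e => [|e ih] u hu.
    by exists u; rewrite subrr; split=> //; apply: leq_trans (dhomog_msize_le hu) _.
  have [et|et] := leqP e.+1 t.
    by exists u; rewrite subrr; split=> //; apply: leq_trans (dhomog_msize_le hu) _.
  have [w [jw hw _]] := addI_dhomog hJ hl hu (large _ _ hu et).
  rewrite subn1 in hw; have [u' [su' ju']] := ih w hw.
  exists u'; split=> //.
  have -> : u - u' = (u - w * l) + w * (l - 1) + (w - u') by ring.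
  apply: (ID _ _ _ ju'); apply: (ID _ _ (addI_base _ jw)); exact: addI_gen.
have sI : spanned I.
  exists 'X_{1..n < t.+1}, (fun y : 'X_{1..n < t.+1} => 'X_[y]) => p.
  have [F' hF'] := functional_choice _ (fun e => red_homog e _ (pihomogP mdeg e p)).
  pose p' := \sum_(e < msize p) F' e.
  have sp' : (msize p' <= t.+1)%N by apply: msize_suml => e _; case: (hF' e).
  exists (fun y : 'X_{1..n < t.+1} => p'@_y); rewrite -mpolywE //.
  rewrite {1}(pihomog_partitionE (leqnn (msize p))) -sumrB.
  by apply: ideal_sum => // e _; case: (hF' e).
(* This is the value of the pencil at [a] as a polynomial in [z]. The exponents are distinct, so it
   is nonzero once some [F k] does not vanish at [a]. *)
pose P a : {poly K} := \sum_(k < r | Q k) (F k).@[a] *: 'X^(eps k).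
have zI a : zero_of I a -> zero_of J a /\ l.@[a] = 1.
  move=> za; split=> [q jq|]; first by apply: za; apply: addI_base.
  apply/eqP; rewrite -subr_eq0 -(meval1 a) -mevalB; apply/eqP/za.
  by rewrite -[X in I X]mul1r; apply: addI_gen.
have [||z hz] := @zeros_avoid I P iI sI.
- by move=> a b ab; apply: eq_bigr => k _; rewrite (meval_eq _ ab).
- move=> a /zI [za la]; have [k Qk hk] := noz a za la.
  apply: contraNneq hk => /polyP /(_ (eps k)); rewrite coef0 coef_sum => <-.
  rewrite (bigD1 k) //= coefZ coefXn eqxx mulr1 big1 ?addr0 // => j /andP [Qj jk].
  rewrite coefZ coefXn; case: eqP => [/inj jk'|_]; last by rewrite mulr0.
  by rewrite jk' ?eqxx in jk.
pose G := \sum_(k < r | Q k) z ^+ eps k *: F k; exists z.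
have hG : G \is D.-homog by apply: rpred_sum => k Qk; apply/rpredZ/hF.
apply: (dehomogenize_unit (hideal_addI hJ hG) hl).
suff : addI I G 1.
  by case=> q [b jb]; exists b, q; move: jb; congr J; ring.
(* If this ideal were proper it would have a zero [a], and [G] would vanish there against the choice
   of [z]. *)
apply: NNPP => n1; have [|a za] := zero_exists (ideal_addI G iI) _ n1.
  by apply: spanned_sub sI => p; apply: addI_base.
have zIa : zero_of I a by move=> q jq; apply: za; apply: addI_base.
move/eqP: (hz a zIa); apply.
rewrite -(za G); last by rewrite -[X in addI _ _ X]mul1r; apply: addI_gen.
rewrite /P /G horner_sum raddf_sum; apply: eq_bigr => k _.
by rewrite hornerZ hornerXn /= mevalZ mulrC.
Qed.

End Points.

(** * The variables as the initial regular sequence *)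

Section Coordinates.
Variables (K : closedFieldType) (n : nat).
Local Notation R := {mpoly K[n]}.

(** Membership in the ideal of the variables in [S] is tested by setting them to 0, a map into a
    domain that fixes [X_i]. *)
Lemma strongly_regular_X : strongly_regular (fun i : 'I_n => 'X_i : R).
Proof.
move=> S i iS; set a := fun i : 'I_n => _.
pose lq := [tuple if j \in S then 0 else 'X_j : R | j < n].
have lqE j : 'X_j \mPo lq = if j \in S then 0 else 'X_j.
  by rewrite comp_mpolyXU -tnth_nth tnth_mktuple.
have inS p : idl a S p <-> p \mPo lq = 0.
  split=> [|p0].
    apply: (idl_min (J := fun p => p \mPo lq = 0)) => [|j jS]; last by rewrite /a lqE jS.
    split=> [|p' q' hp hq|p' q' hq]; first exact: comp_mpoly0.
      by rewrite comp_mpolyD hp hq addr0.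
    by rewrite rmorphM /= hq mulr0.
  have : idl a S (p - comp_mpoly lq p).
    pose phi : {rmorphism R -> R} := comp_mpoly lq.
    apply: (rmorph_mod (phi := phi)) => [|c|j] /=; first exact: idl_ideal.
      exact: comp_mpolyC.
    rewrite lqE; case: ifP => jS; last by rewrite subrr; case: (idl_ideal a S).
    by rewrite subr0; apply: (idl_gen a).
  by rewrite p0 subr0.
move=> u /inS; rewrite rmorphM /= lqE (negPf iS) => /eqP.
rewrite mulf_eq0 => /orP [/eqP/(congr1 (mcoeff U_(i)%MM))|/eqP u0]; last exact/inS.
by rewrite mcoeffX eqxx mcoeff0 => /eqP; rewrite oner_eq0.
Qed.

(** The quotient is [K], in degree 0, and the socle form is the constant term. *)
Lemma graded_gorenstein_X :
  graded_gorenstein (idl (fun i : 'I_n => 'X_i : R) setT) 0.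
Proof.
have modX q : idl (fun i : 'I_n => 'X_i : R) setT (q - (q@_0)%:MP).
  pose phi : {rmorphism R -> R} := @mpolyC n K \o mcoeff 0%MM.
  apply: (rmorph_mod (phi := phi)) => [|c|i] /=; first exact: idl_ideal.
    by rewrite mcoeffC eqxx mulr1.
  rewrite mcoeffX (_ : (_ == _) = false) ?mpolyC0 ?subr0.
    by apply: idl_gen; rewrite inE.
  by apply/negbTE; rewrite -mdeg_eq0 mdeg1.
exists (mcoeff 0%MM); split.
- by move=> c p q; rewrite mcoeffD mcoeffZ.
- move=> p Ip _; move: Ip; apply: (idl_min (J := fun p => p@_0 = 0)) => [|i _].
    split=> [|p' q' hp hq|p' q' hq]; first exact: mcoeff0.
      by rewrite mcoeffD hp hq addr0.
    by rewrite (rmorphM (mcoeff 0%MM)) /= hq mulr0.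
  rewrite mcoeffX (_ : (_ == _) = false) //.
  by apply/negbTE; rewrite -mdeg_eq0 mdeg1.
move=> e u hu h; have := modX u; rewrite (_ : u@_0 = 0) ?mpolyC0 ?subr0 //.
have [e0|e0] := eqVneq e 0%N.
  by rewrite -[u]mulr1; apply: h; rewrite e0 // dhomog1.
by apply: (dhomog_nemf_coeff hu); rewrite /= mdeg0 eq_sym.
Qed.

End Coordinates.

(** * Generic triangular combinations and the exchange of variables *)

Section TriangularGenerators.
Variables (K : closedFieldType) (m s : nat) (f : 'I_s -> {mpoly K[m]}).
Hypothesis le_ms : (m <= s)%N.
Local Notation R := {mpoly K[m]}.
Local Notation hc := (pihomog mdeg).
Local Notation d i := (mdegree (f i)).
Local Notation w := (widen_ord le_ms).

Hypothesis d_gt0 : forall i, (0 < d i)%N.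
Hypothesis d_sorted : forall i j : 'I_s, (i <= j)%N -> (d j <= d i)%N.

Definition top_form i : R := hc (d i) (f i).

Hypothesis no_common_zero :
  forall a : 'I_m -> K, (exists i, a i != 0) -> exists k, (top_form k).@[a] != 0.

(** Powers of [X_j] bring all summands to the degree of [f_j], whose own coefficient is 1; distinct
    exponents of [z] leave room for a generic choice. *)
Definition tri_gen (z : K) (j : 'I_m) : R :=
  \sum_(k < s | (j <= k)%N) z ^+ (k - j) *: ('X_j ^+ (d (w j) - d k) * f k).

Definition tri_top (z : K) (j : 'I_m) : R :=
  \sum_(k < s | (j <= k)%N) z ^+ (k - j) *: ('X_j ^+ (d (w j) - d k) * top_form k).

Lemma msize_mdegree i : (msize (f i) <= (d i).+1)%N.
Proof. exact: leqSpred. Qed.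

Lemma dhomog_Xexp (j : 'I_m) e : ('X_j : R) ^+ e \is e.-homog.
Proof.
rewrite -[X in X.-homog]mul1n; apply: dhomogMn.
by rewrite dhomogX /= mdeg1.
Qed.

Lemma tri_summand_dhomog (j : 'I_m) (k : 'I_s) : (j <= k)%N ->
  ('X_j ^+ (d (w j) - d k) * top_form k) \is (d (w j)).-homog.
Proof.
move=> jk; have le : (d k <= d (w j))%N by apply: d_sorted.
rewrite -[X in X.-homog](subnK le); apply: dhomogM; first exact: dhomog_Xexp.
exact: pihomogP.
Qed.

Lemma tri_top_dhomog z j : tri_top z j \is (d (w j)).-homog.
Proof. by apply: rpred_sum => k jk; apply/rpredZ/tri_summand_dhomog. Qed.

Lemma msize_tri_gen z j : (msize (tri_gen z j) <= (d (w j)).+1)%N.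
Proof.
apply: msize_suml => k jk; apply: leq_trans (msizeZ_le _ _) _.
have le : (d k <= d (w j))%N by apply: d_sorted.
rewrite -[d (w j) in X in (_ <= X)%N](subnK le) -addSn.
by apply: msize_mull; rewrite ?msize_mdegree // dhomog_msize_le // dhomog_Xexp.
Qed.

Lemma pihomog_tri_gen z j : hc (d (w j)) (tri_gen z j) = tri_top z j.
Proof.
rewrite raddf_sum; apply: eq_bigr => k jk /=; rewrite linearZ /=; congr (_ *: _).
have le : (d k <= d (w j))%N by apply: d_sorted.
rewrite -[in LHS](subnK le) pihomog_top_mul ?msize_mdegree //; last first.
  by rewrite subnK // dhomog_msize_le // dhomog_Xexp.
by rewrite subnK // pihomog_dE // dhomog_Xexp.
Qed.

(** The stage at which the first [i] variables have been exchanged. *)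
Definition mixed_seq (i : nat) (z : 'I_m -> K) (j : 'I_m) : R :=
  if (j < i)%N then tri_top (z j) j else 'X_j.

Lemma mixed_seq_dhomog i z j :
  mixed_seq i z j \is (if (j < i)%N then d (w j) else 1%N).-homog.
Proof.
rewrite /mixed_seq; case: ifP => _; first exact: tri_top_dhomog.
by rewrite -['X_j]expr1 dhomog_Xexp.
Qed.

(** Suppose all [top_form k] with [k >= i0] vanish at [a]. For [k < i0] the exchanged form is
    [top_form k] plus multiples of later ones, so by descending induction all vanish, although [a]
    is not the origin. *)
Lemma mixed_seq_zero i z (i0 : 'I_m) a : nat_of_ord i0 = i ->
  zero_of (idl (mixed_seq i z) [set~ i0]) a -> ('X_i0).@[a] = 1 ->
  exists2 k : 'I_s, (i0 <= k)%N &
    ('X_i0 ^+ (d (w i0) - d k) * top_form k).@[a] != 0.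
Proof.
move=> i0i za; rewrite mevalXU => a1; apply: NNPP => no.
have [|k] := no_common_zero (a := a); first by exists i0; rewrite a1 oner_neq0.
apply/negP; rewrite negbK.
have [N] := ubnP (s - k)%N; elim: N k => // N ih k leN.
have [ik|ki] := leqP i0 k.
  apply/negPn/negP => k0; apply: no; exists k => //.
  by rewrite mevalM rmorphXn /= mevalXU a1 expr1n mul1r.
have km : (k < m)%N by apply: leq_trans ki (ltnW (ltn_ord i0)).
pose j := Ordinal km; have wj : w j = k by apply: val_inj.
have : (mixed_seq i z j).@[a] = 0.
  apply: za; apply: idl_gen; rewrite !inE -(inj_eq val_inj) /=.
  by rewrite neq_ltn ki.
rewrite /mixed_seq /= -i0i ki /tri_top (bigD1 k) //= subnn expr0 scale1r wj subnn.
rewrite expr0 mul1r mevalD [X in _ + X = _](_ : _ = 0) ?addr0 => [->//|].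
rewrite raddf_sum /= big1 // => k' /andP [kk' nk].
have /eqP e : (top_form k').@[a] == 0.
  by apply: ih; move: kk' nk leN (ltn_ord k'); rewrite -(inj_eq val_inj) /=; lia.
by rewrite mevalZ mevalM e !mulr0.
Qed.

Lemma mixed_seq_regular i : (i <= m)%N -> exists z : 'I_m -> K,
  strongly_regular (mixed_seq i z) /\
  graded_gorenstein (idl (mixed_seq i z) setT)
                    (\sum_(j < m | (j < i)%N) (d (w j) - 1)).
Proof.
elim: i => [|i ih] im.
  exists (fun _ => 0); rewrite big_pred0 //; split.
    exact: (@strongly_regular_X K m).
  exact: (@graded_gorenstein_X K m).
have [z [reg gor]] := ih (ltnW im); pose i0 : 'I_m := Ordinal im.
pose A := mixed_seq i z; pose J := idl A [set~ i0].
pose dg (j : 'I_m) := if (j < i)%N then d (w j) else 1%N.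
have hA j : A j \is (dg j).-homog by apply: mixed_seq_dhomog.
have hJ : hideal J by apply: idl_hideal hA.
have iJ := hJ.1.
have Ai0 : A i0 = 'X_i0 by rewrite /A /mixed_seq /= ltnn.
have hl : ('X_i0 : R) \is 1.-homog by rewrite -['X_i0]expr1 dhomog_Xexp.
have nl : nzd J 'X_i0 by rewrite -Ai0; apply: reg; rewrite !inE eqxx.
have setT_i0 : [set: 'I_m] = i0 |: [set~ i0].
  by apply/setP => j; rewrite !inE orbN.
set t := (\sum_(j < m | _) _)%N in gor.
have gorJ : graded_gorenstein (addI J 'X_i0) t.
  apply: graded_gorenstein_iff gor => p; rewrite setT_i0 -Ai0; exact: idl_setU1.
have [||||z0 [E hE]] := @generic_form K m J 'X_i0 t (d (w i0)) s
  (fun k : 'I_s => (i0 <= k)%N) (fun k => (k - i0)%N)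
  (fun k => 'X_i0 ^+ (d (w i0) - d k) * top_form k) hJ hl.
- by move=> e u hu te; apply: graded_gorenstein_large gorJ hu te.
- by move=> k; apply: tri_summand_dhomog.
- by move=> k k' kk kk' e; apply: val_inj; move: kk kk' e; rewrite /in_mem /=; lia.
- by move=> a za la; apply: mixed_seq_zero za la.
rewrite -/(tri_top z0 i0) in hE; set G := tri_top z0 i0 in hE.
have hG : G \is (d (w i0)).-homog by apply: tri_top_dhomog.
(* Adding [c] keeps the exponent positive and makes the degree [E' - c] of the cofactor [q] a true
   subtraction. *)
pose c := d (w i0); pose E' := (E + c)%N.
have hE' : addI J G ('X_i0 ^+ E').
  by rewrite exprD; apply: idealMr; first exact: ideal_addI.
have [q [jq hq _]] := addI_dhomog hJ hG (dhomog_Xexp i0 E') hE'.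
have nE : nzd J ('X_i0 ^+ E') by apply: nzdX.
(* Both [G] and [q] divide a power of the nonzerodivisor ['X_i0] modulo [J]. *)
have nG : nzd J G by apply: nzd_factor jq nE.
have nq : nzd J q by rewrite mulrC in jq; apply: nzd_factor jq nE.
pose z' j := if j == i0 then z0 else z j.
have Bi0 : mixed_seq i.+1 z' i0 = G by rewrite /mixed_seq /= ltnSn /z' eqxx.
have Bj j : j != i0 -> mixed_seq i.+1 z' j = A j.
  move=> ji; rewrite /A /mixed_seq /z' (negPf ji).
  have -> : (j < i.+1)%N = (j < i)%N; last by [].
  by move: ji; rewrite -(inj_eq val_inj) /= ltnS leq_eqVlt => /negPf ->.
exists z'; split.
  apply: (@strongly_regular_exchange _ _ _ A _ dg c i0) => //.
  - by move=> j; rewrite /dg; case: ifP.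
  - by rewrite Bi0.
  by rewrite Bi0.
have c0 : (0 < c)%N by apply: d_gt0.
apply: (@graded_gorenstein_iff _ _ (addI J G)).
  move=> p; rewrite setT_i0 idl_setU1 Bi0.
  by split=> -[b jb]; exists b; apply: idl_congr jb => j; rewrite !inE => /Bj.
rewrite (bigD1 i0) //= (eq_bigl (fun j : 'I_m => (j < i)%N)); last first.
  move=> j; rewrite -(inj_eq val_inj) /=; lia.
(* The socle degree for the power [E'] of the variable is [t + E' - 1]; dividing by [q], of degree
   [E' - c], leaves [t + c - 1]. *)
apply: (graded_gorenstein_div (s := (c - 1 + t)%N) hJ jq hq nq).
have -> : (c - 1 + t + (E' - d (w i0)) = t + E'.-1)%N.
  by rewrite -/c /E'; lia.
have <- : E'.-1.+1 = E' by rewrite /E'; lia.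
exact: graded_gorensteinX.
Qed.

Lemma tri_top_regular : exists z : 'I_m -> K,
  let G j := tri_top (z j) j in
  strongly_regular G /\
  graded_gorenstein (idl G setT) (\sum_(j < m) (d (w j) - 1)).
Proof.
have [z [reg gor]] := mixed_seq_regular (leqnn m); exists z => G.
have eG j : mixed_seq m z j = G j by rewrite /mixed_seq ltn_ord.
split; first exact: strongly_regular_eq eG reg.
rewrite (eq_bigl (fun j : 'I_m => (j < m)%N)) => [|j]; last by rewrite ltn_ord.
apply: graded_gorenstein_iff gor => p.
by split; apply: idl_congr => k _; rewrite eG.
Qed.

End TriangularGenerators.

(** * H-bases: generators with regular leading forms *)

Section HBasis.
Variables (K : fieldType) (n k : nat) (g : 'I_k -> {mpoly K[n]}) (c : 'I_k -> nat).
Local Notation R := {mpoly K[n]}.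
Local Notation hc := (pihomog mdeg).
Implicit Types (S : {set 'I_k}) (p q r u : R) (e : nat).

Hypothesis g_size : forall j, (msize (g j) <= (c j).+1)%N.

Definition lead (j : 'I_k) : R := hc (c j) (g j).

Lemma lead_dhomog j : lead j \is (c j).-homog.
Proof. exact: pihomogP. Qed.

(* Truncated subtraction forces q i = 0 when c i > e. *)
Definition tideal S e p : Prop := exists q : 'I_k -> R,
  (forall i, (msize (q i) <= e.+1 - c i)%N) /\ p = \sum_(i in S) q i * g i.

Lemma tideal0 S e : tideal S e 0.
Proof.
exists (fun _ => 0); split=> [i|]; first by rewrite msize0.
by rewrite big1 // => i _; rewrite mul0r.
Qed.

Lemma tidealD S e p q : tideal S e p -> tideal S e q -> tideal S e (p + q).
Proof.
move=> [x [hx ->]] [y [hy ->]]; exists (fun i => x i + y i); split=> [i|].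
  exact: msize_addl.
by rewrite -big_split; apply: eq_bigr => i _; rewrite mulrDl.
Qed.

Lemma tidealM S e a p q : (msize q <= a.+1)%N -> tideal S e p -> tideal S (e + a) (p * q).
Proof.
move=> hq [x [hx ->]]; exists (fun i => x i * q); split=> [i|].
  have [le|gt] := leqP (c i) e.
    have -> : ((e + a).+1 - c i = (e.+1 - c i) + a)%N by lia.
    exact: msize_mull.
  have : (msize (x i) <= 0)%N by apply: leq_trans (hx i) _; lia.
  by rewrite leqn0 msize_poly_eq0 => /eqP ->; rewrite mul0r msize0.
by rewrite mulr_suml; apply: eq_bigr => i _; rewrite mulrAC.
Qed.

Lemma tideal_sum S e (T : Type) (l : seq T) (P : pred T) (F : T -> R) :
  (forall i, P i -> tideal S e (F i)) -> tideal S e (\sum_(i <- l | P i) F i).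
Proof. by move=> h; apply: (big_ind (tideal S e)); [exact: tideal0 | exact: tidealD | ]. Qed.

Lemma tideal_mono S S' e e' p : S \subset S' -> (e <= e')%N ->
  tideal S e p -> tideal S' e' p.
Proof.
move=> SS' ee' [x [hx ->]]; exists (fun i => if i \in S then x i else 0).
split=> [i|].
  case: ifP => _; last by rewrite msize0.
  by apply: leq_trans (hx i) _; apply: leq_sub2r.
rewrite [RHS](big_setID S) /= (setIidPr SS') [X in _ = _ + X]big1 ?addr0.
  by apply: eq_bigr => i ->.
by move=> i; rewrite inE => /andP [/negPf -> _]; rewrite mul0r.
Qed.

Lemma tideal_gen S e i q : i \in S -> (msize q <= e.+1 - c i)%N -> tideal S e (q * g i).
Proof.
move=> iS hq; exists (fun j => if j == i then q else 0); split=> [j|].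
  by case: eqP => [->//|_]; rewrite msize0.
rewrite (bigD1 i) //= eqxx big1 ?addr0 // => j /andP [_ /negPf ->].
by rewrite mul0r.
Qed.

Lemma msize_trunc_term e i q : (msize q <= e.+1 - c i)%N -> (msize (q * g i) <= e.+1)%N.
Proof.
move=> hq; have [le|gt] := leqP (c i) e.
  by rewrite -[X in (_ <= X)%N](@subnK (c i)) ?msize_mull //; lia.
have : (msize q <= 0)%N by apply: leq_trans hq _; lia.
by rewrite leqn0 msize_poly_eq0 => /eqP ->; rewrite mul0r msize0.
Qed.

Lemma msize_trunc S e p : tideal S e p -> (msize p <= e.+1)%N.
Proof. by move=> [q [hq ->]]; apply: msize_suml => i _; apply: msize_trunc_term. Qed.

Lemma pihomog_trunc_term e i q : (msize q <= e.+1 - c i)%N ->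
  hc e (q * g i) = hc (e - c i) q * lead i.
Proof.
move=> hq; have [le|gt] := leqP (c i) e.
  by rewrite -[in LHS](subnK le) pihomog_top_mul // -subSn.
have : (msize q <= 0)%N by apply: leq_trans hq _; lia.
by rewrite leqn0 msize_poly_eq0 => /eqP ->; rewrite mul0r !pihomog0 mul0r.
Qed.

Lemma pihomog_trunc S e p : tideal S e p -> idl lead S (hc e p).
Proof.
move=> [q [hq ->]]; exists (fun i => hc (e - c i) (q i)); rewrite raddf_sum.
by apply: eq_bigr => i _; apply: pihomog_trunc_term.
Qed.

(** The homogeneous cofactors of the leading forms are reused for the [g i], which only adds terms
    of degree below [e]. *)
Lemma tideal_lift S e u : u \is e.-homog -> idl lead S u ->
  exists2 r, tideal S e r & hc e r = u.
Proof.
move=> hu [q eu].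
pose q' i := if (c i <= e)%N then hc (e - c i) (q i) else 0.
have hq' i : (msize (q' i) <= e.+1 - c i)%N.
  rewrite /q'; case: (leqP (c i) e) => le; last by rewrite msize0.
  by rewrite subSn //; apply/dhomog_msize_le/pihomogP.
exists (\sum_(i in S) q' i * g i); first by exists q'.
rewrite -[RHS](pihomog_dE hu) eu !raddf_sum; apply: eq_bigr => i _ /=.
rewrite (pihomog_mulr _ _ (lead_dhomog i)) pihomog_trunc_term // /q'.
by case: ifP => _; rewrite ?pihomog_id // pihomog0 mul0r.
Qed.

Lemma idl_trunc S p : idl g S p -> exists e, tideal S e p.
Proof.
move=> [q ->]; exists (\max_i (msize (q i) + c i))%N; exists q; split=> // i.
have : (msize (q i) + c i <= \max_i (msize (q i) + c i))%N.
  exact: (leq_bigmax (F := fun i => (msize (q i) + c i)%N)).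
by move=> h; rewrite -(addnK (c i) (msize (q i))); apply/leq_sub2r/leqW.
Qed.

Lemma tideal_idl S e p : tideal S e p -> idl g S p.
Proof. by move=> [q [_ ->]]; exists q. Qed.

Hypothesis lead_regular : strongly_regular lead.

(* The leading part of the coefficient of g i is a combination of the other
   leading forms, hence can be moved to the other coefficients. *)
Lemma tideal_pred S e p : tideal S e.+1 p -> (msize p <= e.+1)%N -> tideal S e p.
Proof.
have [N] := ubnP #|S|; elim: N S p => // N ih S p leN.
have [->|[i iS]] := set_0Vmem S.
  by move=> [q [_ ->]] _; rewrite big_set0; apply: tideal0.
pose S' := S :\ i; have iS' : i \notin S' by rewrite !inE eqxx.
have S'S : S' \subset S by apply: subD1set.
move=> [q [hq ep]] hp.
have ep' : p = q i * g i + \sum_(j in S') q j * g j.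
  by rewrite ep (big_setD1 i).
have tS' : tideal S' e.+1 (\sum_(j in S') q j * g j) by exists q.
have [ci|ci] := ltnP e.+1 (c i).
  have : (msize (q i) <= 0)%N by apply: leq_trans (hq i) _; lia.
  rewrite leqn0 msize_poly_eq0 => /eqP qi0.
  move: ep'; rewrite qi0 mul0r add0r => ep'.
  apply: (tideal_mono S'S (leqnn e)); apply: ih => //; last by rewrite ep'.
  by move: leN; rewrite (cardsD1 i S) iS /= -/S'; lia.
(* [Q] is the top part of [q i]. As [p] has no component of degree [e + 1], the product of [Q] and
   [lead i] lies in the ideal of the other leading forms; regularity removes [lead i]. *)
pose e1 := (e.+1 - c i)%N; pose Q := hc e1 (q i).
have idQ : idl lead S' Q.
  apply: (lead_regular iS').
  have := congr1 (hc e.+1) ep'; rewrite (pihomog_msize_le hp) pihomogD.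
  rewrite pihomog_trunc_term // -/e1 -/Q mulrC => /esym/eqP.
  rewrite addr_eq0 => /eqP ->; rewrite -mulN1r.
  by have [_ _ M] := idl_ideal lead S'; apply: M; apply: pihomog_trunc.
(* [r] is in the truncated ideal of the others with top part [Q]. Thus [(q i - r) * g i] fits the
   bound [e], and [r * g i] is charged to the others. *)
have [r tr hr] := tideal_lift (pihomogP mdeg e1 (q i)) idQ.
have sq : (msize (q i - r) <= e1)%N.
  apply: msize_drop_top => //; last exact: msize_trunc tr.
  by rewrite /e1 -subSn //; apply: hq.
have sqg : (msize ((q i - r) * g i) <= e.+1)%N by apply: msize_trunc_term.
rewrite -(subrK ((q i - r) * g i) p); apply: tidealD; last exact: tideal_gen.
apply: (tideal_mono S'S (leqnn e)); apply: ih.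
- by move: leN; rewrite (cardsD1 i S) iS /= -/S'; lia.
- have -> : p - (q i - r) * g i = \sum_(j in S') q j * g j + r * g i.
    by rewrite ep'; ring.
  by apply: tidealD => //; rewrite -(subnK ci); apply: tidealM.
exact: msize_subl.
Qed.

Lemma tideal_tight S e e' p : tideal S e' p -> (msize p <= e.+1)%N -> tideal S e p.
Proof.
elim: e' => [|e' ih] tp sp; first by apply: tideal_mono tp.
have [le|gt] := leqP e'.+1 e; first by apply: tideal_mono le tp.
by apply: ih => //; apply: tideal_pred => //; apply: leq_trans sp _.
Qed.

Variable sigma : nat.
Hypothesis lead_gorenstein : graded_gorenstein (idl lead setT) sigma.

(** Above degree [sigma] every form lies in the leading ideal, so the top part can be lifted and
    subtracted. *)
Lemma reduce_mod q e : (msize q <= e.+1)%N ->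
  exists2 q', (msize q' <= sigma.+1)%N & tideal setT e (q - q').
Proof.
elim: e q => [|e ih] q sq.
  by exists q; [apply: leq_trans sq _ | rewrite subrr; apply: tideal0].
have [le|gt] := leqP e.+1 sigma.
  by exists q; [apply: leq_trans sq _ | rewrite subrr; apply: tideal0].
have hq := pihomogP mdeg e.+1 q.
have [r tr hr] := tideal_lift hq (graded_gorenstein_large lead_gorenstein hq gt).
have [|q' sq' tq'] := ih (q - r).
  by apply: msize_drop_top => //; apply: msize_trunc tr.
exists q' => //; have -> : q - q' = (q - r - q') + r by ring.
by apply: tidealD => //; apply: tideal_mono (leqnSn e) tq'.
Qed.

Lemma reduce_idl q : exists q', (msize q' <= sigma.+1)%N /\ idl g setT (q - q').
Proof.
by have [q' sq' /tideal_idl tq'] := reduce_mod (leqnSn (msize q)); exists q'.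
Qed.

(** The value at [p] is [lam] of the component of degree [sigma] of a representative of [p] of
    degree at most [sigma]. *)
Lemma lift_socle_form : exists2 Lam : R -> K, linform Lam &
  (forall p, idl g setT p -> Lam p = 0) /\
  (forall a, (forall b, Lam (a * b) = 0) -> idl g setT a).
Proof.
have [lam [L Z N]] := lead_gorenstein; have iI := idl_ideal g setT.
have [W HW] := functional_choice _ reduce_idl.
(* By [tideal_tight], a member of the ideal of degree at most [sigma] has its component of degree
   [sigma] in the leading ideal, where [lam] vanishes. *)
have uniq p q : (msize p <= sigma.+1)%N -> (msize q <= sigma.+1)%N ->
    idl g setT (p - q) -> lam (hc sigma p) = lam (hc sigma q).
  move=> sp sq /idl_trunc [e te].
  have {te} := tideal_tight te (msize_subl sp sq) => /pihomog_trunc.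
  rewrite pihomogB => /Z h; apply/eqP; rewrite -subr_eq0 -linformB // h //.
  by rewrite rpredB // pihomogP.
have lamW p q : (msize q <= sigma.+1)%N -> idl g setT (p - q) ->
    lam (hc sigma (W p)) = lam (hc sigma q).
  move=> sq jq; have [sW jW] := HW p; apply: uniq => //.
  have -> : W p - q = (p - q) - (p - W p) by ring.
  exact: idealB.
have lam0 : lam 0 = 0 by have := L (-1) 0 0; rewrite scaler0 addr0 mulN1r addNr.
have Lin : linform (fun p => lam (hc sigma (W p))).
  move=> x p q; rewrite -L; have [sp jp] := HW p; have [sq jq] := HW q.
  have -> : x *: hc sigma (W p) + hc sigma (W q) = hc sigma (x *: W p + W q).
    by rewrite pihomogD linearZ.
  apply: lamW; first by apply: msize_addl => //; apply: leq_trans (msizeZ_le _ _) _.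
  have -> : x *: p + q - (x *: W p + W q) = x *: (p - W p) + (q - W q).
    by rewrite scalerBr; set y := x *: p; set y' := x *: W p; ring.
  by have [_ D _] := iI; apply: D => //; apply: idealZ.
have Kill p : idl g setT p -> lam (hc sigma (W p)) = 0.
  by move=> jp; rewrite (lamW p 0) ?subr0 ?msize0 // pihomog0.
exists (fun p => lam (hc sigma (W p))) => //; split=> // a ha.
have [s1 j1] := HW a; apply: (ideal_congr iI j1).
have {}ha b : lam (hc sigma (W (W a * b))) = 0.
  have -> : W a * b = a * b - (a - W a) * b by ring.
  have -> : lam (hc sigma (W (a * b - (a - W a) * b))) =
      lam (hc sigma (W (a * b))) - lam (hc sigma (W ((a - W a) * b))).
    exact: (linformB (lam := fun p => lam (hc sigma (W p)))).
  by rewrite ha Kill ?subrr //; apply: idealMr.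
(* Induction on the degree of [u]: its top part pairs to zero with the forms of complementary
   degree, so it lies in the leading ideal and can be lifted and subtracted. *)
suff H : forall e u, (msize u <= e)%N -> (e <= sigma.+1)%N ->
    (forall b, lam (hc sigma (W (u * b))) = 0) -> idl g setT u.
  exact: H s1 (leqnn _) ha.
elim=> [|e ih] u su se hu.
  by move: su; rewrite leqn0 msize_poly_eq0 => /eqP ->; case: iI.
have hcu := pihomogP mdeg e u.
have [|r tr hr] := tideal_lift (S := setT) hcu.
  apply: (N _ _ hcu) => v le hv; rewrite -(hu v).
  have sv := dhomog_msize_le hv.
  have es : (e + (sigma - e) = sigma)%N by lia.
  rewrite (lamW _ (u * v)); last by rewrite subrr; case: iI.
    by rewrite -[in RHS]es pihomog_top_mul // (pihomog_dE hv).
  by rewrite -es -addSn; apply: msize_mull.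
have jr := tideal_idl tr; apply: (ideal_congr (q := r) iI) => //.
apply: ih; [|exact: ltnW|].
  by apply: msize_drop_top => //; apply: msize_trunc tr.
move=> b; rewrite mulrBl.
have -> : lam (hc sigma (W (u * b - r * b))) =
      lam (hc sigma (W (u * b))) - lam (hc sigma (W (r * b))).
  exact: (linformB (lam := fun p => lam (hc sigma (W p)))).
by rewrite hu Kill ?subrr //; apply: idealMr.
Qed.

End HBasis.

(** * Truncated ideals of the original generators *)

Section Truncation.
Variables (K : closedFieldType) (m s : nat) (f : 'I_s -> {mpoly K[m]}).
Hypothesis le_ms : (m <= s)%N.
Local Notation R := {mpoly K[m]}.
Local Notation d i := (mdegree (f i)).
Local Notation w := (widen_ord le_ms).

Hypothesis d_sorted : forall i j : 'I_s, (i <= j)%N -> (d j <= d i)%N.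

Variable z : 'I_m -> K.
Local Notation g := (fun j => tri_gen f le_ms (z j) j).
Local Notation c := (fun j : 'I_m => d (w j)).
Local Notation df := (fun i : 'I_s => d i).
Let Sm := [set i : 'I_s | (m <= i)%N].
Let sigma := (\sum_(j < m) (d (w j) - 1))%N.

Lemma tideal_tri_sub e p : tideal g c setT e p -> tideal f df setT e p.
Proof.
move=> [q [hq ->]]; apply: tideal_sum => j _.
have [le|gt] := leqP (d (w j)) e; last first.
  have : (msize (q j) <= 0)%N by apply: leq_trans (hq j) _; lia.
  by rewrite leqn0 msize_poly_eq0 => /eqP ->; rewrite mul0r; apply: tideal0.
rewrite mulrC -(subnKC le); apply: tidealM; first by rewrite -subSn.
apply: tideal_sum => k jk; rewrite scalerAl; apply: tideal_gen; first by rewrite inE.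
rewrite (leq_trans (msizeZ_le _ _)) // subSn; last exact: d_sorted.
by apply/dhomog_msize_le/dhomog_Xexp.
Qed.

(** The generators beyond the first [m] are kept, while the first [m] give way to the [g j], all
    within the same degree bound. *)
Definition split_trunc e (p : R) : Prop :=
  exists2 p2, tideal f df Sm e p2 & tideal g c setT e (p - p2).

Lemma split_truncD e p q : split_trunc e p -> split_trunc e q -> split_trunc e (p + q).
Proof.
move=> [a ha ha'] [b hb hb']; exists (a + b); first exact: tidealD.
by have := tidealD ha' hb'; congr tideal; ring.
Qed.

Lemma split_truncM e a p q : (msize q <= a.+1)%N -> split_trunc e p ->
  split_trunc (e + a) (p * q).
Proof.
move=> sq [b hb hb']; exists (b * q); first exact: tidealM.
by rewrite -mulrBl; apply: tidealM.
Qed.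

Lemma split_trunc0 e : split_trunc e 0.
Proof. by exists 0; rewrite ?subrr; apply: tideal0. Qed.

(** Back substitution from the last index: [f k] is the triangular generator minus multiples of
    later [f k'], none exceeding degree [d k]. *)
Lemma split_trunc_f k : split_trunc (d k) (f k).
Proof.
have [N] := ubnP (s - k)%N; elim: N k => // N ih k leN.
have [mk|km] := leqP m k.
  exists (f k); last by rewrite subrr; apply: tideal0.
  rewrite -[X in tideal _ _ _ _ X]mul1r; apply: tideal_gen; first by rewrite inE.
  by rewrite msize1 subSn ?leqnn.
pose j := Ordinal km; have wj : w j = k by apply: val_inj.
have fkE : f k = tri_gen f le_ms (z j) j +
  \sum_(k' < s | (j <= k')%N && (k' != k))
     (f k' * 'X_j ^+ (d k - d k')) * (- (z j ^+ (k' - j)))%:MP.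
  rewrite /tri_gen (bigD1 k) //= subnn expr0 scale1r wj subnn expr0 mul1r.
  rewrite -addrA -big_split /= big1 ?addr0 // => k' _.
  by rewrite mpolyCN mulrN [_ * _%:MP]mulrC mul_mpolyC [f k' * _]mulrC subrr.
rewrite [X in split_trunc _ X]fkE; apply: split_truncD.
  exists 0; first exact: tideal0.
  rewrite subr0 -[tri_gen _ _ _ _]mul1r; apply: (@tideal_gen _ _ _ g c).
    by rewrite inE.
  by rewrite /= wj msize1 subSn ?leqnn.
apply: (big_ind (split_trunc (d k))); [exact: split_trunc0 | exact: split_truncD |].
move=> k' /andP [kk' nk]; rewrite -[X in split_trunc X]addn0; apply: split_truncM.
  by rewrite msizeC; case: eqP.
have le : (d k' <= d k)%N by apply: d_sorted.
rewrite -(subnKC le); apply: split_truncM.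
  by rewrite subnKC //; apply/dhomog_msize_le/dhomog_Xexp.
apply: ih; move: kk' nk leN (ltn_ord k'); rewrite -(inj_eq val_inj) /=; lia.
Qed.

Lemma tideal_split e p : tideal f df setT e p -> split_trunc e p.
Proof.
move=> [q [hq ->]].
apply: (big_ind (split_trunc e)); [exact: split_trunc0 | exact: split_truncD |].
move=> k _; have [le|gt] := leqP (d k) e; last first.
  have : (msize (q k) <= 0)%N by apply: leq_trans (hq k) _; lia.
  by rewrite leqn0 msize_poly_eq0 => /eqP ->; rewrite mul0r; apply: split_trunc0.
rewrite mulrC -(subnKC le); apply: split_truncM (split_trunc_f k).
by rewrite -subSn.
Qed.

Hypothesis top_regular : strongly_regular (fun j => tri_top f le_ms (z j) j).
Hypothesis top_gorenstein :
  graded_gorenstein (idl (fun j => tri_top f le_ms (z j) j) setT) sigma.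

Let g_size j : (msize (g j) <= (c j).+1)%N := msize_tri_gen le_ms d_sorted (z j) j.

Let lead_top : (fun j => tri_top f le_ms (z j) j) =1 lead g c.
Proof. by move=> j; rewrite /lead pihomog_tri_gen. Qed.

Lemma lead_tri_regular : strongly_regular (lead g c).
Proof. exact: strongly_regular_eq lead_top top_regular. Qed.

Lemma lead_tri_gorenstein : graded_gorenstein (idl (lead g c) setT) sigma.
Proof.
apply: graded_gorenstein_iff top_gorenstein => p.
by split; apply: idl_congr => i _; rewrite lead_top.
Qed.

(** Coefficients of the generators beyond the first [m] are reduced modulo the [g j] to degree at
    most [sigma], so these terms have degree at most [k]. The remainder lies in the ideal of the
    [g j] and also has degree at most [k], so the H-basis property applies. *)
Lemma tideal_stable k e p : (forall i : 'I_s, (m <= i)%N -> (sigma + d i <= k)%N) ->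
  tideal f df setT e p -> (msize p <= k.+1)%N -> tideal f df setT k p.
Proof.
move=> hk /tideal_split [p2 [q [hq e2]] tp] sp.
have red i : exists q', (msize q' <= sigma.+1)%N /\
    tideal g c setT e ((q i - q') * f i).
  have [le|gt] := leqP (d i) e; last first.
    have : (msize (q i) <= 0)%N by apply: leq_trans (hq i) _; lia.
    rewrite leqn0 msize_poly_eq0 => /eqP ->; exists 0.
    by rewrite msize0 subrr mul0r; split=> //; apply: tideal0.
  have [|q' sq' tq'] := reduce_mod g_size lead_tri_gorenstein (q := q i) (e := e - d i).
    by rewrite -subSn.
  exists q'; split=> //; rewrite -(subnK le); apply: tidealM tq'.
  exact: msize_mdegree.
have [q' hq'] := functional_choice _ red.
pose p2' := \sum_(i in Sm) q' i * f i.
have t2 : tideal f df Sm k p2'.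
  apply: tideal_sum => i iS; apply: tideal_gen => //.
  apply: leq_trans (hq' i).1 _; rewrite inE in iS; have := hk i iS; lia.
have t1 : tideal g c setT e (p - p2').
  have -> : p - p2' = (p - p2) + \sum_(i in Sm) (q i - q' i) * f i.
    have -> : \sum_(i in Sm) (q i - q' i) * f i = p2 - p2'.
      by rewrite e2 -sumrB; apply: eq_bigr => i _; rewrite mulrBl.
    by ring.
  by apply: tidealD => //; apply: tideal_sum => i _; case: (hq' i).
have s1 : (msize (p - p2') <= k.+1)%N.
  by apply: msize_subl => //; apply: msize_trunc t2; apply: msize_mdegree.
rewrite -(subrK p2' p); apply: tidealD.
  apply: tideal_tri_sub; exact: tideal_tight g_size lead_tri_regular _ _ _ _ t1 s1.
by apply: tideal_mono t2; rewrite ?subsetT.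
Qed.

Lemma idl_tri p : s = m -> idl g setT p <-> idl f setT p.
Proof.
move=> sm; split.
  by move=> /(@idl_trunc _ _ _ g c) [e /tideal_tri_sub /tideal_idl].
move=> /(@idl_trunc _ _ _ f df) [e /tideal_split [p2 [q [_ e2]] /tideal_idl]].
rewrite e2 big_pred0 ?subr0 // => i.
by rewrite inE leqNgt -sm ltn_ord.
Qed.

Lemma tri_gorenstein : s = m -> gorenstein_quotient f.
Proof.
move=> sm; have inf p : in_ideal f p <-> idl g setT p.
  rewrite idl_tri //; split=> -[q ->]; exists q;
  by apply: eq_bigl => i; rewrite inE.
split.
  (* By [reduce_idl], monomials of degree at most [sigma] span the quotient. *)
  pose T : finType := 'X_{1..m < sigma.+1}; pose X (u : T) : R := 'X_[u].
  exists #|T|, (fun i => X (enum_val i)) => p.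
  have [p' [sp' jp']] := reduce_idl g_size lead_tri_gorenstein p.
  exists (fun i => p'@_(enum_val i : T)); apply/inf.
  move: jp'; rewrite {1}(mpolywE sp') (reindex (@enum_val T T)) //.
  exact/onW_bij/enum_val_bij.
have [Lam L [kill nd]] :=
  lift_socle_form g_size lead_tri_regular lead_tri_gorenstein.
exists Lam; split=> //; split=> [p /inf|a ha]; first exact: kill.
by apply/inf; apply: nd.
Qed.

End Truncation.

(** * Dimension counts, constant generators and points at infinity *)

Lemma bounded_max (P : nat -> Prop) N : P 0%N -> (forall i, P i -> (i <= N)%N) ->
  exists i, P i /\ forall j, P j -> (j <= i)%N.
Proof.
elim: N => [|N ih] P0 bP; first by exists 0%N.
have [PN|nPN] := classic (P N.+1); first by exists N.+1.
apply: ih => // i Pi; have := bP i Pi; rewrite leq_eqVlt => /orP [/eqP iN|//].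
by rewrite iN in Pi.
Qed.

Section Star.
Variables (K : fieldType) (m s : nat) (f : 'I_s -> {mpoly K[m]}).
Local Notation R := {mpoly K[m]}.

Lemma deg_le_msize (k : nat) (p : R) : deg_le k%:Z p <-> (msize p <= k.+1)%N.
Proof.
have [->|p0] := eqVneq p 0; first by rewrite msize0; split=> // _; left.
rewrite (mpolySpred mdeg p0) ltnS -/(mdegree p); split; last by right; rewrite lez_nat.
by case=> [e|]; [rewrite e eqxx in p0 | rewrite lez_nat].
Qed.

(** As [W] contains 0, independence modulo [W] implies linear independence, so lengths are bounded
    by the number of monomials of degree at most [|k|]. *)
Lemma quot_dim_exists (k : int) (W : R -> Prop) : W 0 ->
  exists n, quot_dim (deg_le k) W n.
Proof.
move=> W0; pose T : finType := 'X_{1..m < `|k|.+1}.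
pose P n := exists b : 'I_n -> R, (forall i, deg_le k (b i)) /\ indep_mod W b.
have [||n [Pn maxn]] := @bounded_max P #|T|.
- by exists (fun _ => 0); split=> [|c _] [].
- move=> n [b [bk bi]]; rewrite leqNgt; apply/negP => ltn.
  pose A := \matrix_(i < n, u < #|T|) (b i)@_(enum_val u : T).
  have [v v0 vA] := left_kernel_neq0 A ltn.
  move/eqP: v0; apply; apply/rowP => i; rewrite mxE.
  apply: (bi (fun i => v 0 i)).
  suff -> : \sum_i v 0 i *: b i = 0 by [].
  apply/mpolyP => u; rewrite mcoeff0 raddf_sum /=.
  under eq_bigr do rewrite mcoeffZ.
  have [lt|ge] := ltnP (mdeg u) `|k|.+1.
    have := congr1 (fun M : 'rV_#|T| => M 0 (enum_rank (BMultinom lt : T))) vA.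
    rewrite !mxE => e; rewrite -[RHS]e.
    by apply: eq_bigr => j _; rewrite mxE enum_rankK.
  rewrite big1 // => j _.
  suff /msize_leP -> : (msize (b j) <= `|k|.+1)%N by rewrite ?mulr0.
  apply/deg_le_msize; case: (bk j) => [->|h]; first by left.
  by right; apply: le_trans h _; rewrite abszE ler_norm.
by exists n; split=> // n' b bk bi; apply: maxn; exists b.
Qed.

(** Truncated ideals grow with [d]; with the converse inclusion in degrees at most [k], the
    subspaces coincide and one dimension serves for all [d]. *)
Lemma cond_star_stable (k : int) :
  (forall d p, k <= d -> deg_le k p -> trunc_ideal f d p -> trunc_ideal f k p) ->
  cond_star f k k.
Proof.
move=> st; have [|n [[b [bk bi]] mx]] :=
  @quot_dim_exists k (fun p => trunc_ideal f k p /\ deg_le k p).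
  split; last by left.
  by exists (fun _ => 0); split=> [i|]; [left | rewrite big1 // => i _; rewrite mul0r].
exists n => d kd.
have eqW p : trunc_ideal f d p /\ deg_le k p <-> trunc_ideal f k p /\ deg_le k p.
  split=> -[tp dp]; split=> //; first exact: st tp.
  have [q [hq ->]] := tp; exists q; split=> // i; case: (hq i) => [->|h]; [by left|].
  by right; apply: le_trans h _; rewrite lerD2r.
split; first by exists b; split=> // c /eqW; apply: bi.
by move=> n' b' bk' bi'; apply: mx bk' _ => c /eqW; apply: bi'.
Qed.

(** When [e] is below the degree of [f i], the integer bound is negative and the truncated one is 0;
    both force [q i = 0]. *)
Lemma trunc_ideal_tideal (e : nat) (p : R) :
  trunc_ideal f e%:Z p <-> tideal f (fun i => mdegree (f i)) setT e p.
Proof.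
have sz (q : R) i : q = 0 \/ ((mdegree q)%:Z <= e%:Z - (mdegree (f i))%:Z) <->
    (msize q <= e.+1 - mdegree (f i))%N.
  have [->|q0] := eqVneq q 0; first by rewrite msize0; split=> // _; left.
  rewrite (mpolySpred mdeg q0) -/(mdegree q); split.
    by case=> [e0|]; [rewrite e0 eqxx in q0 | lia].
  by move=> h; right; lia.
split=> -[q [hq ->]]; exists q; (split; first by move=> i; apply/sz);
by apply: eq_bigl => i; rewrite inE.
Qed.

(** The exchange of variables needs positive degrees, so constant generators are treated apart;
    dividing by one preserves degrees. *)
Lemma const_ideal i (p : R) : f i != 0 -> mdegree (f i) = 0%N ->
  exists2 c : K, c != 0 & p = (c *: p) * f i.
Proof.
move=> f0 d0; have /msize_poly1P [c c0 ->] : msize (f i) == 1%N.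
  by rewrite (mpolySpred mdeg f0) -/(mdegree (f i)) d0.
exists c^-1; first by rewrite invr_eq0.
by rewrite mulrC mul_mpolyC scalerA divff // scale1r.
Qed.

Lemma cond_star_const i k : f i != 0 -> mdegree (f i) = 0%N -> cond_star f k k.
Proof.
move=> f0 d0; apply: cond_star_stable => _ p _ dp _.
have [c c0 ep] := const_ideal p f0 d0.
exists (fun j => if j == i then c *: p else 0); split=> [j|].
  case: eqP => [->|_]; last by left.
  rewrite d0 subr0; case: dp => [->|dp]; first by left; rewrite scaler0.
  by right; rewrite /mdegree msizeZ.
rewrite (bigD1 i) //= eqxx -ep big1 ?addr0 // => j /negPf ->.
by rewrite mul0r.
Qed.

Lemma gorenstein_const i : f i != 0 -> mdegree (f i) = 0%N -> gorenstein_quotient f.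
Proof.
move=> f0 d0; have all p : in_ideal f p.
  have [c c0 ep] := const_ideal p f0 d0.
  exists (fun j => if j == i then c *: p else 0).
  rewrite (bigD1 i) //= eqxx -ep big1 ?addr0 // => j /negPf ->.
  by rewrite mul0r.
split; first by exists 0%N, (fun _ => 0) => p; exists (fun _ => 0).
by exists (fun _ => 0); do ?split=> // *; rewrite mulr0 addr0.
Qed.

(** Where the last variable is 0, only the terms of full degree survive. *)
Lemma homogenize_at_infinity (p : R) (v : 'I_m.+1 -> K) : v ord_max = 0 ->
  (homogenize p).@[v] =
  (pihomog mdeg (mdegree p) p).@[fun i => v (widen_ord (leqnSn m) i)].
Proof.
move=> v0; rewrite /homogenize pihomogE !raddf_sum /= [RHS]big_mkcond /=.
rewrite !big_seq; apply: eq_bigr => u up.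
rewrite mevalZ mevalM rmorph_prod rmorphXn /= mevalXU v0.
have lt := msize_mdeg_lt up; case: eqP => [ud|/eqP ud].
  rewrite ud subnn expr0 mulr1 mevalZ mevalX; congr (_ * _).
  by apply: eq_bigr => i _; rewrite rmorphXn /= mevalXU.
have /prednK <- : (0 < mdegree p - mdeg u)%N.
  by rewrite subn_gt0 ltn_neqAle ud -ltnS /mdegree (ltn_predK lt).
by rewrite expr0n /= !mulr0.
Qed.

(** A common zero of the leading forms, extended by a last coordinate 0, would be a root at
    infinity. *)
Lemma no_common_zero_top (a : 'I_m -> K) : no_root_at_infinity f ->
  (exists i, a i != 0) -> exists k, (pihomog mdeg (mdegree (f k)) (f k)).@[a] != 0.
Proof.
move=> hinf [i ai]; apply: NNPP => no.
pose v (j : 'I_m.+1) := oapp a 0 (unlift ord_max j).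
have vmax : v ord_max = 0 by rewrite /v unlift_none.
have vw j : v (widen_ord (leqnSn m) j) = a j.
  have -> : widen_ord (leqnSn m) j = lift ord_max j.
    by apply: val_inj; rewrite /= /bump leqNgt ltn_ord.
  by rewrite /v liftK.
have : v ord_max != 0; last by rewrite vmax eqxx.
apply: hinf; split; first by exists (widen_ord (leqnSn m) i); rewrite vw.
move=> j; rewrite homogenize_at_infinity // (meval_eq _ vw).
by apply/eqP/negPn/negP => nz; apply: no; exists j.
Qed.

End Star.

(** * The cases [s = m] and [s > m] *)

Theorem theorem3p1 (K : closedFieldType) (m s : nat) (f : 'I_s -> {mpoly K[m]})
  (f_neq0 : forall i, f i != 0)
  (deg_sorted : forall i j : 'I_s, (i <= j)%N -> (mdegree (f j) <= mdegree (f i))%N)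
  (hfin : finitely_many_proj_roots f)
  (hinf : no_root_at_infinity f) :
  (s = m ->
     let k := \sum_(i < s) ((mdegree (f i))%:Z - 1) in
     cond_star f k k /\ gorenstein_quotient f) /\
  ((m < s)%N ->
     let k := \sum_(i < s | (i <= m)%N) (mdegree (f i))%:Z - m%:Z in
     cond_star f k k).
Proof.
have [[i0 di0]|nconst] := classic (exists i, mdegree (f i) = 0%N).
  split=> _ k; last exact: cond_star_const di0.
  by split; [apply: cond_star_const di0 | apply: gorenstein_const di0].
have d_gt0 i : (0 < mdegree (f i))%N.
  by rewrite lt0n; apply/eqP => di; apply: nconst; exists i.
(* Both cases reduce to a natural [k] bounding the socle degree plus [d i] for every generator
   beyond the first [m]. *)
have star (le_ms : (m <= s)%N) (k : nat) :
    (forall i : 'I_s, (m <= i)%N ->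
      (\sum_(j < m) (mdegree (f (widen_ord le_ms j)) - 1) + mdegree (f i) <= k)%N) ->
    cond_star f k%:Z k%:Z.
  move=> hk; have [z [reg gor]] :=
    tri_top_regular le_ms d_gt0 deg_sorted (fun a => no_common_zero_top hinf).
  apply: cond_star_stable => -[e|//] p _ /deg_le_msize sp /trunc_ideal_tideal te.
  by apply/trunc_ideal_tideal; apply: tideal_stable reg gor _ _ _ hk te sp.
split=> [sm k|ms k].
  have le_ms : (m <= s)%N by rewrite sm.
  split; last first.
    have [z [reg gor]] :=
      tri_top_regular le_ms d_gt0 deg_sorted (fun a => no_common_zero_top hinf).
    exact: tri_gorenstein reg gor sm.
  have -> : k = (\sum_(i < s) (mdegree (f i) - 1))%N%:Z.
    rewrite /k (big_morph Posz PoszD (erefl _)); apply: eq_bigr => i _.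
    by rewrite -subzn.
  (* For [s = m] no index satisfies [m <= i], so the bound is vacuous. *)
  by apply: (star le_ms) => i mi; have := ltn_ord i; rewrite {2}sm ltnNge mi.
pose im := Ordinal ms; have le_ms := ltnW ms.
pose t := (\sum_(j < m) (mdegree (f (widen_ord le_ms j)) - 1))%N.
(* Counting from 0, [im] is the first index beyond the first [m], hence carries the largest
   remaining degree; the [m] units subtracted in [k] are absorbed by [t]. *)
have -> : k = (t + mdegree (f im))%N%:Z.
  rewrite /k (big_ord_narrow ms) big_ord_recr /= PoszD.
  rewrite (_ : widen_ord ms ord_max = im); last exact: val_inj.
  rewrite addrAC; congr (_ + _).
  have -> : m%:Z = \sum_(j < m) 1%:Z.
    by rewrite sumr_const card_ord -natz.
  rewrite -sumrB /t (big_morph Posz PoszD (erefl _)); apply: eq_bigr => j _.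
  rewrite -subzn //; congr (Posz (mdegree (f _)) - _); exact: val_inj.
by apply: (star le_ms) => i mi; rewrite leq_add2l; apply: deg_sorted.
Qed.
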